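(* Let $d\ge 2$ be an integer and let $u\in S$ be a $(d-1)$-bounded monomial of degree $d$. Then the $(d-1)$-Borel ideal $B_{d-1}(u)$ is Freiman if and only if the Borel ideal $B(u)$ is Freiman.
   Context: Throughout, $n\ge 3$ is an integer, $K$ is a field, $S=K[x_1,\ldots,x_n]$ is the polynomial ring and $\mathfrak m=(x_1,\ldots,x_n)$. For a monomial ideal $I\subset S$, $G(I)$ is its unique minimal set of monomial generators and $\mu(I)=|G(I)|$. $I$ is equigenerated if all elements of $G(I)$ have the same degree. The analytic spread $\ell(I)$ is the Krull dimension of the fiber ring $F(I)=\bigoplus_{k\ge 0}I^k/\mathfrak m I^k$. An equigenerated monomial ideal $I$ is called Freiman if $\mu(I^2)=\ell(I)\mu(I)-\binom{\ell(I)}{2}$. For a monomial $u$, $\mathrm{supp}(u)=\{i: x_i\mid u\}$. A monomial ideal $I$ is Borel if for every $u\in G(I)$, every $j\in\mathrm{supp}(u)$ and every $i<j$ one has $x_i(u/x_j)\in I$; $B(u)$ denotes the unique smallest (with respect to inclusion) Borel ideal containing the monomial $u$. Let $k$ be a positive integer. A monomial $x_1^{a_1}\cdots x_n^{a_n}$ is $k$-bounded if $a_i\le k$ for all $i$. A monomial ideal $I$ generated by $k$-bounded monomials is $k$-Borel if for every $k$-bounded monomial $u\in I$, every $j\in\mathrm{supp}(u)$ and every $i<j$ one has $x_i(u/x_j)\in I$ provided $x_i(u/x_j)$ is again $k$-bounded. For a $k$-bounded monomial $u$, $B_k(u)$ is the unique smallest (with respect to inclusion) $k$-Borel ideal containing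 $u$. *)

(* Defs.v *)
From HB Require Import structures.
From mathcomp Require Import all_boot all_order all_algebra ring_quotient finmap.
From mathcomp Require Import boolp classical_sets cardinality mpoly.

Set Implicit Arguments.
Unset Strict Implicit.
Unset Printing Implicit Defensive.

Import GRing.Theory.

Local Open Scope ring_scope.
Local Open Scope classical_set_scope.

Section IdealOperations.
Variable R : comNzRingType.
Implicit Types A B I J : set R.

Definition ideal_gen A : set R :=
  [set f | exists2 s : seq (R * R), (forall p, p \in s -> A p.2) &
             f = \sum_(p <- s) p.1 * p.2].

Definition ideal_mul I J : set R :=
  ideal_gen [set h | exists f g, [/\ I f, J g & h = f * g]].

Fixpoint ideal_exp I k : set R :=
  if k is k'.+1 then ideal_mul I (ideal_exp I k') else setT.

Lemma ideal_gen0 A : ideal_gen A 0.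
Proof. by exists [::]; rewrite ?big_nil. Qed.

Lemma ideal_gen_in A f : A f -> ideal_gen A f.
Proof.
move=> Af; exists [:: (1, f)]; last by rewrite big_seq1 mul1r.
by move=> p; rewrite inE => /eqP->.
Qed.

Lemma ideal_genD A f g : ideal_gen A f -> ideal_gen A g -> ideal_gen A (f + g).
Proof.
move=> [s sA ->] [t tA ->]; exists (s ++ t); last by rewrite big_cat.
by move=> p; rewrite mem_cat => /orP[/sA|/tA].
Qed.

Lemma ideal_genMl A a f : ideal_gen A f -> ideal_gen A (a * f).
Proof.
move=> [s sA ->]; exists [seq (a * p.1, p.2) | p <- s].
  by move=> p /mapP[q qs ->] /=; apply: sA.
by rewrite big_map mulr_sumr; apply: eq_bigr => p _; rewrite mulrA.
Qed.

Lemma ideal_genN A f : ideal_gen A f -> ideal_gen A (- f).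
Proof. by rewrite -mulN1r; apply: ideal_genMl. Qed.

Lemma ideal_gen_sum A (T : Type) (s : seq T) (P : pred T) (F : T -> R) :
  (forall i, P i -> ideal_gen A (F i)) -> ideal_gen A (\sum_(i <- s | P i) F i).
Proof.
move=> AF; elim/big_ind: _ => //; [exact: ideal_gen0|exact: ideal_genD].
Qed.

(* [ideal_gen A] is the least ideal containing [A]. *)
Lemma ideal_gen_min A B :
  B 0 -> (forall f g, B f -> B g -> B (f + g)) ->
  (forall a f, B f -> B (a * f)) -> A `<=` B ->
  forall f, ideal_gen A f -> B f.
Proof.
move=> B0 BD BM AB f [s sA ->]; rewrite big_seq; elim/big_ind: _ => //.
by move=> p /sA/AB; apply: BM.
Qed.
Arguments ideal_gen_min [A] B.

Lemma ideal_mul_in I J f g : I f -> J g -> ideal_mul I J (f * g).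
Proof. by move=> If Jg; apply: ideal_gen_in; exists f, g. Qed.

Lemma ideal_exp0 I k : ideal_exp I k 0.
Proof. by case: k => //= k; apply: ideal_gen0. Qed.

Lemma ideal_expD I k f g :
  ideal_exp I k f -> ideal_exp I k g -> ideal_exp I k (f + g).
Proof. by case: k => //= k; apply: ideal_genD. Qed.

Lemma ideal_expMl I k a f : ideal_exp I k f -> ideal_exp I k (a * f).
Proof. by case: k => //= k; apply: ideal_genMl. Qed.

Lemma ideal_expM I j k f g :
  ideal_exp I j f -> ideal_exp I k g -> ideal_exp I (j + k) (f * g).
Proof.
move=> If Ig; elim: j f If => [|j IH] f; first by move=> _; apply: ideal_expMl.
rewrite addSn; move: f.
refine (ideal_gen_min [set x | ideal_exp I (j + k).+1 (x * g)] _ _ _ _) => /=.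
- by rewrite mul0r; apply: ideal_gen0.
- by move=> x y; rewrite mulrDl; apply: ideal_genD.
- by move=> a x; rewrite -mulrA; apply: ideal_genMl.
move=> _ [x [y [Ix Iy ->]]] /=; rewrite -mulrA.
by apply: ideal_mul_in => //; apply: IH.
Qed.

Lemma ideal_mul_expM M I j k f g : ideal_exp I j f ->
  ideal_mul M (ideal_exp I k) g -> ideal_mul M (ideal_exp I (j + k)) (f * g).
Proof.
move=> If; move: g.
refine (ideal_gen_min
  [set x | ideal_mul M (ideal_exp I (j + k)) (f * x)] _ _ _ _) => /=.
- by rewrite mulr0; apply: ideal_gen0.
- by move=> x y; rewrite mulrDr; apply: ideal_genD.
- by move=> a x; rewrite mulrCA; apply: ideal_genMl.
move=> _ [x [y [Mx Iy ->]]] /=; rewrite mulrCA.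
by apply: ideal_mul_in => //; apply: ideal_expM.
Qed.

End IdealOperations.
Arguments ideal_gen_min [R A] B.

(* The Rees algebra (+)_k I^k t^k, as a subring of R[t]. *)
Section ReesAlgebra.
Variables (R : comNzRingType) (I : set R).

Definition rees_pred : {pred {poly R}} :=
  fun p => `[< forall k : nat, ideal_exp I k p`_k >].

Lemma rees_predP (p : {poly R}) :
  reflect (forall k : nat, ideal_exp I k p`_k) (p \in rees_pred).
Proof. exact: asboolP. Qed.

Lemma rees_subring_closed : subring_closed rees_pred.
Proof.
split.
- by apply/rees_predP => -[|k] //; rewrite coef1; apply: ideal_exp0.
- move=> p q /rees_predP Ip /rees_predP Iq; apply/rees_predP => k.
  by rewrite coefB -mulN1r; apply: ideal_expD => //; apply: ideal_expMl.
move=> p q /rees_predP Ip /rees_predP Iq; apply/rees_predP => k.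
rewrite coefM; elim/big_ind: _ => [|x y|[i /= ilek] _].
- exact: ideal_exp0.
- exact: ideal_expD.
by rewrite -{1}(@subnKC i k) //; apply: ideal_expM.
Qed.

HB.instance Definition _ :=
  GRing.isSubringClosed.Build {poly R} rees_pred rees_subring_closed.

Record rees := Rees { rees_val : {poly R}; _ : rees_val \in rees_pred }.

HB.instance Definition _ := [isSub for rees_val].
HB.instance Definition _ := [Choice of rees by <:].
HB.instance Definition _ := [SubChoice_isSubComNzRing of rees by <:].

End ReesAlgebra.

Section KrullDimension.
Variable A : comNzRingType.

Definition prime_ideal (P : {pred A}) : Prop :=
  idealr_closed P /\ prime_idealr_closed P.

Definition prime_chain (c : nat) (P : nat -> {pred A}) : Prop :=
  (forall i, (i <= c)%N -> prime_ideal (P i)) /\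
  (forall i, (i < c)%N ->
     {subset P i <= P i.+1} /\ ~ {subset P i.+1 <= P i}).

Definition krull_dim (d : nat) : Prop :=
  (exists P, prime_chain d P) /\
  (forall c P, prime_chain c P -> (c <= d)%N).

End KrullDimension.

Section FiberRing.
Variables (n : nat) (K : fieldType).
Implicit Types I : set {mpoly K[n]}.

Definition irrelevant_ideal : set {mpoly K[n]} :=
  ideal_gen (range (fun i : 'I_n => 'X_i)).

Lemma irrelevant_coef0 f : irrelevant_ideal f -> f@_0 = 0.
Proof.
move: f; refine (ideal_gen_min [set f : {mpoly K[n]} | f@_0 = 0] _ _ _ _) => /=.
- by rewrite mcoeff0.
- by move=> f g f0 g0; rewrite mcoeffD f0 g0 addr0.
- by move=> a f f0; rewrite rmorphM /= f0 mulr0.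
move=> _ [i _ <-] /=.
by rewrite mcoeffX mnm1_eq0.
Qed.

(* The ideal (+)_k (m I^k) t^k of the Rees algebra of I. *)
Definition fiber_pred I : {pred rees I} :=
  fun p => `[< forall k : nat,
                 ideal_mul irrelevant_ideal (ideal_exp I k) (val p)`_k >].

Arguments fiber_pred : clear implicits.

Lemma fiber_predP I (p : rees I) :
  reflect (forall k : nat,
             ideal_mul irrelevant_ideal (ideal_exp I k) (val p)`_k)
          (p \in fiber_pred I).
Proof. exact: asboolP. Qed.

Lemma fiber_idealr_closed I : idealr_closed (fiber_pred I).
Proof.
split.
- by apply/fiber_predP => k; rewrite raddf0 coef0; apply: ideal_gen0.
- apply/fiber_predP => /(_ 0%N); rewrite rmorph1 coef1 /= => h.
  suff: (1 : {mpoly K[n]})@_0 = 0 by rewrite mcoeff1 eqxx => /eqP; rewrite oner_eq0.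
  apply: irrelevant_coef0; move: h.
  apply: (ideal_gen_min irrelevant_ideal).
  + exact: ideal_gen0.
  + exact: ideal_genD.
  + exact: ideal_genMl.
  by move=> _ [f [g [If _ ->]]]; rewrite mulrC; apply: ideal_genMl.
move=> a u v /fiber_predP Iu /fiber_predP Iv; apply/fiber_predP => k.
rewrite rmorphD rmorphM /= coefD; apply: ideal_genD; last exact: Iv.
rewrite coefM; apply: ideal_gen_sum => -[i /= ilek] _.
rewrite -{1}(@subnKC i k) //; apply: ideal_mul_expM => //.
by case: a => a /= /rees_predP.
Qed.

HB.instance Definition _ I :=
  isIdealr.Build (rees I) (fiber_pred I) (fiber_idealr_closed I).

(* (+)_k I^k t^k modulo (+)_k m I^k t^k, i.e. (+)_k I^k / m I^k with the
   product induced by that of the powers of I. *)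
Definition fiber_ring I : comNzRingType := {ideal_quot (fiber_pred I)}.

Definition analytic_spread I (l : nat) : Prop := krull_dim (fiber_ring I) l.

End FiberRing.

Section MonomialIdeals.
Variables (n : nat) (K : fieldType).
Implicit Types (m u : 'X_{1..n}) (A : set 'X_{1..n}) (I J : set {mpoly K[n]}).

Definition mono_ideal A : set {mpoly K[n]} :=
  ideal_gen [set f | exists2 m, A m & f = 'X_[m]].

Definition monomial_ideal I : Prop := exists A, I = mono_ideal A.

(* G(I): the least set of monomials generating I; see [mono_ideal_mingens]. *)
Definition mingens I : set 'X_{1..n} :=
  [set m | forall A, I = mono_ideal A -> A m].

(* G(I) is finite for every monomial ideal I (Dickson's lemma), so that the
   default value of [fset_set] on infinite sets is irrelevant. *)
Definition mu I : nat := #|` fset_set (mingens I)|%fset.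

Definition equigenerated I : Prop :=
  exists d : nat, forall m, mingens I m -> mdeg m = d.

Definition freiman I : Prop :=
  [/\ monomial_ideal I, equigenerated I &
      exists2 l : nat, analytic_spread I l &
        (mu (ideal_exp I 2))%:Z = l%:Z * (mu I)%:Z - ('C(l, 2))%:Z].

Definition mnm_shift m (i j : 'I_n) : 'X_{1..n} := (m - U_(j) + U_(i))%MM.

Definition borel I : Prop :=
  monomial_ideal I /\
  forall m (i j : 'I_n), mingens I m -> (0 < m j)%N -> (i < j)%N ->
    I 'X_[mnm_shift m i j].

(* B(u); see [principal_borel_least]. *)
Definition principal_borel u : set {mpoly K[n]} :=
  \bigcap_(J in [set J | borel J /\ J 'X_[u]]) J.

Definition bounded (k : nat) m : Prop := forall i : 'I_n, (m i <= k)%N.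

Definition kborel (k : nat) I : Prop :=
  (exists2 A, A `<=` bounded k & I = mono_ideal A) /\
  forall m (i j : 'I_n), bounded k m -> I 'X_[m] -> (0 < m j)%N -> (i < j)%N ->
    bounded k (mnm_shift m i j) -> I 'X_[mnm_shift m i j].

(* B_k(u); see [principal_kborel_least]. *)
Definition principal_kborel (k : nat) u : set {mpoly K[n]} :=
  \bigcap_(J in [set J | kborel k J /\ J 'X_[u]]) J.

Lemma mono_ideal_supp A f : mono_ideal A f ->
  forall m, m \in msupp f -> exists2 a, A a & (a <= m)%MM.
Proof.
move: f; refine (ideal_gen_min
  [set f : {mpoly K[n]} | forall m, m \in msupp f ->
     exists2 a, A a & (a <= m)%MM] _ _ _ _) => /=.
- by move=> m; rewrite msupp0.
- by move=> f g hf hg m /msuppD_le; rewrite mem_cat => /orP[/hf|/hg].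
- move=> a f hf m /msuppM_le /allpairsP[[m1 m2] /= [_ /hf[b Ab ble] ->]].
  by exists b => //; apply: lepm_trans ble _; apply: lem_addl.
move=> _ [a Aa ->] m; rewrite msuppX inE => /eqP->; exists a => //.
exact: lepm_refl.
Qed.

Lemma mono_idealX A m : mono_ideal A 'X_[m] <-> exists2 a, A a & (a <= m)%MM.
Proof.
split=> [/mono_ideal_supp h|[a Aa ale]]; first by apply: h; rewrite msuppX inE.
by rewrite -(submK ale) mpolyXD; apply/ideal_genMl/ideal_gen_in; exists a.
Qed.

Lemma mono_ideal_of_supp A f :
  (forall m, m \in msupp f -> exists2 a, A a & (a <= m)%MM) -> mono_ideal A f.
Proof.
move=> h; rewrite (mpolyE f) big_seq; apply: ideal_gen_sum => m /h am.
by rewrite -mul_mpolyC; apply: ideal_genMl; apply/mono_idealX.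
Qed.

Lemma mono_idealP A f :
  mono_ideal A f <-> forall m, m \in msupp f -> exists2 a, A a & (a <= m)%MM.
Proof.
split; last exact: mono_ideal_of_supp.
exact: mono_ideal_supp.
Qed.

Lemma mingens_le I m : monomial_ideal I -> I 'X_[m] ->
  exists2 a, mingens I a & (a <= m)%MM.
Proof.
move=> [A IA]; have [d] := ubnP (mdeg m); elim: d m => // d IH m md Im.
have [[a [aI am anm]]|nex] :=
  pselect (exists a, [/\ I 'X_[a], (a <= m)%MM & a != m]).
  have ad : (mdeg a < d)%N.
    have e : mdeg m = (mdeg (m - a) + mdeg a)%N by rewrite -mdegD submK.
    have : (0 < mdeg (m - a))%N.
      rewrite lt0n mdeg_eq0; apply: contra anm => /eqP e0.
      by rewrite -(submK am) e0 add0m.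
    move=> p; move: md; rewrite e ltnS; apply: leq_trans.
    by rewrite -addn1 addnC leq_add2r.
  by have [b Gb ba] := IH a ad aI; exists b => //; apply: lepm_trans ba am.
exists m; last exact: lepm_refl.
move=> B IB; move: (Im); rewrite IB => /mono_idealX[b Bb bm].
suff -> : m = b by [].
apply/eqP; rewrite eq_sym; apply: contra_notT nex => bnm; exists b; split=> //.
by rewrite IB; apply/mono_idealX; exists b => //; apply: lepm_refl.
Qed.

Lemma mono_ideal_mingens I : monomial_ideal I -> mono_ideal (mingens I) = I.
Proof.
move=> mI; have [A IA] := mI; rewrite eqEsubset; split=> f.
  move/mono_idealP=> h; rewrite IA; apply/mono_idealP => m /h[a Ga am].
  by exists a => //; apply: Ga.
move=> If; apply/mono_idealP => m mf; apply: mingens_le => //.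
by rewrite IA; apply/mono_idealX; move: If; rewrite IA => /mono_idealP; apply.
Qed.

Lemma monomial_bigcap (C : set (set {mpoly K[n]})) (k : 'X_{1..n} -> 'X_{1..n}) :
  (forall m, (k m <= m)%MM) ->
  (forall J, C J -> exists2 A, J = mono_ideal A &
     forall a m, A a -> (a <= m)%MM -> (a <= k m)%MM) ->
  \bigcap_(J in C) J =
    mono_ideal [set a | (exists m, a = k m) /\ forall J, C J -> J 'X_[a]].
Proof.
move=> km CA; rewrite eqEsubset; split=> f.
  move=> h; apply/mono_idealP => m mf; exists (k m) => //.
  split=> [|J CJ]; first by exists m.
  have [A JA Ak] := CA J CJ.
  have [a Aa am] : exists2 a, A a & (a <= m)%MM.
    by apply: mono_ideal_supp mf; rewrite -JA; apply: h.
  by rewrite JA; apply/mono_idealX; exists a => //; apply: Ak.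
move/mono_idealP => h J CJ; have [A JA _] := CA J CJ; rewrite JA.
apply/mono_idealP => m /h [a [_ /(_ J CJ)]]; rewrite JA => /mono_idealX[b Ab ba am].
by exists b => //; apply: lepm_trans ba am.
Qed.

Lemma borel_all I m (i j : 'I_n) : borel I -> I 'X_[m] -> (0 < m j)%N ->
  (i < j)%N -> I 'X_[mnm_shift m i j].
Proof.
move=> [mI bI] Im mj ij; have [a Ga am] := mingens_le mI Im.
have [A IA] := mI.
have [aj|aj] := posnP (a j).
  rewrite IA; apply/mono_idealX; exists a; first exact: Ga.
  apply/mnm_lepP => l; rewrite /mnm_shift mnmDE mnmBE !mnm1E.
  have [<-|_] := eqVneq j l; first by rewrite aj.
  by rewrite subn0; apply: leq_trans (leq_addr _ _); apply/mnm_lepP.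
have := bI a i j Ga aj ij; rewrite IA => /mono_idealX[b Ab ba].
apply/mono_idealX; exists b => //; apply: lepm_trans ba _.
apply/mnm_lepP => l; rewrite /mnm_shift !mnmDE !mnmBE leq_add2r leq_sub2r //.
exact/mnm_lepP.
Qed.

Lemma principal_borel_least u :
  [/\ borel (principal_borel u), principal_borel u 'X_[u] &
      forall J, borel J -> J 'X_[u] -> principal_borel u `<=` J].
Proof.
split; [split | by move=> J [] | by move=> J bJ Ju f; apply].
  eexists; apply: (@monomial_bigcap _ id) => [m|J [[[A ->] _] _]].
    exact: lepm_refl.
  by exists A.
move=> m i j Gm mj ij J [bJ Ju]; apply: borel_all => //.
have [A EA] : monomial_ideal (principal_borel u).
  eexists; apply: (@monomial_bigcap _ id) => [a|L [[[A ->] _] _]].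
    exact: lepm_refl.
  by exists A.
suff : principal_borel u 'X_[m] by apply.
by rewrite EA; apply/mono_idealX; exists m; [apply: Gm|apply: lepm_refl].
Qed.

Lemma principal_kborel_least k u :
  [/\ kborel k (principal_kborel k u), principal_kborel k u 'X_[u] &
      forall J, kborel k J -> J 'X_[u] -> principal_kborel k u `<=` J].
Proof.
split; [split | by move=> J [] | by move=> J bJ Ju f; apply].
  pose t (m : 'X_{1..n}) : 'X_{1..n} := [multinom minn (m i) k | i < n].
  eexists; last apply: (@monomial_bigcap _ t) => [m|J [[[A Ak ->] _] _]].
  - by move=> _ [[m ->] _] i; rewrite mnmE geq_minr.
  - by apply/mnm_lepP => i; rewrite mnmE geq_minl.
  exists A => // a m Aa am; apply/mnm_lepP => i; rewrite mnmE leq_min.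
  by rewrite (mnm_lepP am) (Ak _ Aa).
move=> m i j bm Im mj ij bs J [bJ Ju]; apply: bJ.2 => //.
by apply: Im.
Qed.

End MonomialIdeals.

Arguments fiber_pred [n K] I _.
Arguments principal_borel [n] K u.
Arguments principal_kborel [n] K k u.

(* Main.v *)
Require Import Defs.
From HB Require Import structures.
From mathcomp Require Import all_boot all_order all_algebra.
From mathcomp Require Import ring_quotient finmap boolp classical_sets cardinality.
From mathcomp Require Import mpoly zify.

(* Let s (resp. M) be the least (resp. greatest) index of a variable dividing u. The
   generators of B(u) are the monomials of degree d = deg u whose exponents have
   prefix sums at least those of u; B_{d-1}(u) loses only the powers x_i^d with
   i <= s. Dealing out the variables of a monomial alternately to two factors
   shows that the generators of the squares are described in the same way by
   u^2, with exponents at most 2(d-1) in the case of B_{d-1}(u); so the square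
   loses exactly the monomials x_i^(2d-1) x_j with i <= s and j <= M. Counting
   indices from 1, mu drops by s and mu of the square by sM. Both analytic spreads
   equal M unless u = x_1^(d-1) x_M, when the one of B_{d-1}(u) and its number of
   generators are both M - 1; in each case the two Freiman equations are
   equivalent.

   The analytic spreads come from an embedding of the fiber ring into a polynomial
   ring in l variables. A chain of primes cannot be longer than l, since elements
   f_i of P_{i+1} outside P_i satisfy no polynomial relation; the kernels of the
   successive substitutions x_1 = 1, ..., x_l = 1 form a chain of length l as soon
   as the exponents span a lattice of rank l. *)

Set Implicit Arguments.
Unset Strict Implicit.
Unset Printing Implicit Defensive.

Import GRing.Theory.

(** * Krull dimension of subalgebras of polynomial rings *)

Section AlgebraicDependence.
Local Open Scope ring_scope.
Variable K : fieldType.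

Lemma row_dependence (X Y : finType) (g : X -> Y -> K) : (#|Y| < #|X|)%N ->
  exists2 c : X -> K, (exists x, c x != 0) & forall y, \sum_x c x * g x y = 0.
Proof.
move=> ltYX; pose M := \matrix_(i < #|X|, j < #|Y|) g (enum_val i) (enum_val j).
have kM : kermx M != 0.
  rewrite -mxrank_eq0 mxrank_ker -lt0n subn_gt0.
  exact: leq_ltn_trans (rank_leq_col M) ltYX.
exists (fun x => nz_row (kermx M) 0 (enum_rank x)).
  have : nz_row (kermx M) != 0 by rewrite nz_row_eq0.
  by case/rV0Pn=> i vi; exists (enum_val i); rewrite enum_valK.
move=> y; have /sub_kermxP/rowP/(_ (enum_rank y)) := nz_row_sub (kermx M).
rewrite !mxE; apply: etrans; rewrite (reindex (@enum_val X predT)) /=.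
  by apply: eq_bigr => i _; rewrite !mxE enum_rankK enum_valK.
by exists enum_rank => x _; rewrite ?enum_valK ?enum_rankK.
Qed.

Variable l : nat.

Lemma mdeg_supp_prod (I : Type) (s : seq I) (f : I -> {mpoly K[l]}) (b : I -> nat) :
  (forall i, {in msupp (f i), forall m, (mdeg m <= b i)%N}) ->
  {in msupp (\prod_(i <- s) f i), forall m, (mdeg m <= \sum_(i <- s) b i)%N}.
Proof.
move=> fb; elim: s => [|i s IH] m.
  by rewrite big_nil msupp1 inE => /eqP->; rewrite mdeg0.
rewrite !big_cons => /msuppM_le/allpairsP[[m1 m2] /= [/fb h1 /IH h2 ->]].
by rewrite mdegD leq_add.
Qed.

(* Pigeonhole: the products [\prod_i f i ^+ e i] with [e i < N] number
   [N ^ l.+1], but they span a space of dimension [O(N ^ l)]. *)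
Lemma algebraic_dependence (f : 'I_l.+1 -> {mpoly K[l]}) :
  exists N (c : {ffun 'I_l.+1 -> 'I_N} -> K),
    (exists e, c e != 0) /\ \sum_e c e *: \prod_i f i ^+ e i = 0.
Proof.
(* The products have degree at most [(l+1)(N-1)D], which is below [B N], so [(B N)^l] columns hold
   all their coefficients; this is less than [N^(l+1)] because [B^l < N]. *)
pose D := (\max_i msize (f i))%N; pose B := (l.+1 * D).+1.
pose N := (B ^ l).+1.
pose g (e : {ffun 'I_l.+1 -> 'I_N}) (y : {ffun 'I_l -> 'I_(B * N)}) :=
  (\prod_i f i ^+ e i)@_[multinom (y j : nat) | j < l].
have degf i : {in msupp (f i), forall m, (mdeg m <= D)%N}.
  move=> m /msize_mdeg_lt/ltnW lem; apply: leq_trans lem _.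
  exact: (@leq_bigmax _ (fun i => msize (f i))).
have degg (e : {ffun 'I_l.+1 -> 'I_N}) : {in msupp (\prod_i f i ^+ e i), forall m, (mdeg m < B * N)%N}.
  have degX i : {in msupp (f i ^+ e i), forall m, (mdeg m <= N.-1 * D)%N}.
    move=> m; rewrite -(subn0 (e i)) -prodr_const_nat.
    move=> /(mdeg_supp_prod (fun=> degf i)); rewrite sum_nat_const_nat subn0.
    by move/leq_trans; apply; rewrite leq_mul2r [X in _ || X](ltn_ord (e i)) orbT.
  move=> m /(mdeg_supp_prod degX); rewrite sum_nat_const cardT size_enum_ord.
  by move/leq_ltn_trans; apply; rewrite /B /N /=; nia.
have [|c cn0 c0] := @row_dependence _ _ g.
  by rewrite !card_ffun !card_ord expnS expnMn ltn_pmul2r ?expn_gt0.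
exists N, c; split=> //; apply/mpolyP => m; rewrite mcoeff0 raddf_sum /=.
have [/existsP[j mj]|/existsPn mj] := boolP [exists j, (B * N <= m j)%N].
  apply: big1 => e _; rewrite mcoeffZ memN_msupp_eq0 ?mulr0 //.
  apply/negP => /degg; rewrite ltnNge => /negP[]; apply: leq_trans mj _.
  by rewrite mdegE (bigD1 j) //= leq_addr.
have ltm j : (m j < B * N)%N by rewrite ltnNge mj.
apply: etrans (c0 [ffun j => Ordinal (ltm j)]); apply: eq_bigr => e _.
rewrite mcoeffZ /g; congr (_ * _@_ _); apply/mnmP => j.
by rewrite mnmE ffunE.
Qed.

End AlgebraicDependence.

(** * Chains of prime ideals *)

Section PrimeChains.
Local Open Scope ring_scope.
Variable A : comNzRingType.

Lemma prime_ideal_kernel (B : idomainType) (f : {rmorphism A -> B}) :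
  prime_ideal [pred a | f a == 0].
Proof.
split; last by move=> a b; rewrite !inE rmorphM mulf_eq0.
split.
- by rewrite inE rmorph0.
- by rewrite inE rmorph1 oner_eq0.
by move=> a b c; rewrite !inE rmorphD rmorphM => /eqP-> /eqP->; rewrite mulr0 addr0.
Qed.

(* The terms of the relation whose exponent vectors are lexicographically
   minimal are isolated one coordinate at a time: once the terms in [S] agree
   on the first [j] coordinates, their sum, stripped of these coordinates,
   lies in [P j]. *)
Lemma prime_chain_independence c (P : nat -> {pred A}) (f : nat -> A)
    (X : finType) (a : X -> A) (e : X -> nat -> nat) :
  prime_chain c P ->
  (forall i, (i < c)%N -> f i \in P i.+1 /\ f i \notin P i) ->
  (forall x y, (forall i, (i < c)%N -> e x i = e y i) -> x = y) ->
  (forall x, a x != 0 -> exists b, b * a x = 1) ->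
  (exists x, a x != 0) ->
  \sum_x a x * \prod_(0 <= i < c) f i ^+ e x i != 0.
Proof.
move=> [primeP chainP] fP inje unita [x0 ax0]; apply/negP => /eqP sum0.
(* At level [c] the terms of [S] agree in all exponents, so [S] is a singleton whose coefficient, a
   unit, would lie in [P c]. *)
suff [S [x Sx] [agree nz inP]] : exists2 S : {set X}, (exists x, x \in S) &
    [/\ forall x y, x \in S -> y \in S -> forall i, (i < c)%N -> e x i = e y i,
        forall x, x \in S -> a x != 0
      & \sum_(x in S) a x * \prod_(c <= i < c) f i ^+ e x i \in P c].
  have [[_ P1 Pl] _] := primeP c (leqnn c).
  have [P0 _ _] := (primeP c (leqnn c)).1.
  have S1 : S = [set x].
    apply/setP => y; rewrite inE; apply/idP/eqP => [Sy|->//].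
    by apply: inje => i ic; apply: agree.
  have [b ba] := unita x (nz x Sx).
  move: inP; rewrite S1 big_set1 big_geq // mulr1 => ax; case/negP: P1.
  by rewrite -ba -[b * _]addr0; apply: Pl.
have: (c <= c)%N by [].
(* Induction on the number of isolated coordinates; the upper end [c] of the remaining products
   stays fixed. *)
move: {1 3 4 6}c; elim=> [|j IH] jc.
  exists [set x | a x != 0]; first by exists x0; rewrite inE.
  split=> [//|x|]; first by rewrite inE.
  have [P0 _ _] := (primeP 0 jc).1.
  suff -> : \sum_(x in [set x | a x != 0]) a x * \prod_(0 <= i < c) f i ^+ e x i = 0.
    by [].
  rewrite -[RHS]sum0 [RHS](bigID (fun x => a x != 0)) /= [X in _ + X]big1 ?addr0.
    by apply: eq_bigl => x; rewrite inE.
  by move=> x; rewrite negbK => /eqP->; rewrite mul0r.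
have [S [x Sx] [agree nz inP]] := IH (ltnW jc).
have [fj1 fj0] := fP j jc.
pose x1 := [arg min_(y < x in S) e y j].
have [Sx1 minx1] : x1 \in S /\ forall y, y \in S -> (e x1 j <= e y j)%N.
  by rewrite /x1; case: arg_minnP.
pose r y := \prod_(j.+1 <= i < c) f i ^+ e y i.
have fac : \sum_(y in S) a y * \prod_(j <= i < c) f i ^+ e y i =
    f j ^+ e x1 j * \sum_(y in S) a y * (f j ^+ (e y j - e x1 j) * r y).
  rewrite mulr_sumr; apply: eq_bigr => y Sy.
  rewrite big_ltn // [RHS]mulrCA; congr (_ * _).
  by rewrite [RHS]mulrA -exprD subnKC ?minx1.
have [[P0 P1 Pl] Pp] := primeP j (ltnW jc).
(* [P j] is prime and omits [f j], so the common power of [f j] can be cancelled. *)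
have {fac} : \sum_(y in S) a y * (f j ^+ (e y j - e x1 j) * r y) \in P j.
  move: inP; rewrite fac => /Pp/orP[fje|//]; case/negP: fj0.
  elim: (e x1 j) fje => [|k IHk]; first by rewrite expr0 (negPf P1).
  by rewrite exprS => /Pp/orP[].
move/(chainP j jc).1.
rewrite (bigID (fun y => e y j == e x1 j)) /=.
have [[Q0 Q1 Ql] Qp] := primeP j.+1 jc.
have Qadd u v : u \in P j.+1 -> v \in P j.+1 -> u + v \in P j.+1.
  by move=> Pu Pv; rewrite -[u]mul1r; apply: Ql.
set u := \sum_(y in S | e y j != _) _.
(* Terms with a larger exponent keep a factor [f j], which lies in [P j.+1]. *)
have Qu : u \in P j.+1.
  rewrite /u; elim/big_ind: _ => // y /andP[Sy neq].
  have : (0 < e y j - e x1 j)%N by rewrite subn_gt0 ltn_neqAle eq_sym neq minx1.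
  case: (e y j - e x1 j)%N => // k _.
  by rewrite exprSr mulrAC mulrA -[_ * f j]addr0; apply: Ql.
move=> Quv; have {Quv} : \sum_(y in S | e y j == e x1 j) a y * r y \in P j.+1.
  suff : (-1) * u + (u + \sum_(y in S | e y j == e x1 j) a y * r y) \in P j.+1.
    by rewrite mulN1r addKr.
  apply: Ql => //; rewrite addrC.
  have <- : \sum_(y in S | e y j == e x1 j) a y * (f j ^+ (e y j - e x1 j) * r y)
      = \sum_(y in S | e y j == e x1 j) a y * r y.
    by apply: eq_bigr => y /andP[_ /eqP->]; rewrite subnn expr0 mul1r.
  exact: Quv.
exists [set y in S | e y j == e x1 j]; first by exists x1; rewrite inE Sx1 eqxx.
split.
- move=> y z; rewrite !inE => /andP[Sy /eqP ey] /andP[Sz /eqP ez] i.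
  rewrite ltnS leq_eqVlt => /orP[/eqP->|]; first by rewrite ey ez.
  exact: agree.
- by move=> y; rewrite inE => /andP[/nz].
by rewrite (eq_bigl (fun y => (y \in S) && (e y j == e x1 j))) // => y; rewrite inE.
Qed.

Lemma krull_dim_unique d1 d2 : krull_dim A d1 -> krull_dim A d2 -> d1 = d2.
Proof.
move=> [[P1 c1] m1] [[P2 c2] m2]; apply/eqP; rewrite eqn_leq.
by rewrite (m2 _ _ c1) (m1 _ _ c2).
Qed.

End PrimeChains.

Section Subalgebras.
Local Open Scope ring_scope.
Variables (K : fieldType) (l : nat) (A : comNzRingType).
Variable F : {rmorphism A -> {mpoly K[l]}}.
Hypothesis injF : forall a, F a = 0 -> a = 0.
Hypothesis constF : forall c, exists a, F a = c%:MP.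

(** A longer chain has [l + 1] elements [f i] of [P i.+1] outside [P i]. Their images are
    algebraically dependent; the relation lifts to [A] by [constF] and [injF], against
    [prime_chain_independence]. *)
Lemma prime_chain_leq_vars c (P : nat -> {pred A}) : prime_chain c P -> (c <= l)%N.
Proof.
move=> [primeP chainP]; rewrite leqNgt; apply/negP => lc.
have [f fP] : exists f : nat -> A,
    forall i, (i < l.+1)%N -> f i \in P i.+1 /\ f i \notin P i.
  suff /choice : forall i, exists x, (i < l.+1)%N -> x \in P i.+1 /\ x \notin P i.
    by case=> f fP; exists f.
  move=> i; have [il|_] := ltnP i l.+1; last by exists 0.
  have [_ nsub] := chainP i (leq_trans il lc).
  apply: contrapT => nex; apply: nsub => x Px; apply: contrapT => nPx.
  by apply: nex; exists x => _; split=> //; apply/negP.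
have /choice[iota Fiota] := constF.
have [N [cf [[e0 ce0] rel]]] := algebraic_dependence (fun i : 'I_l.+1 => F (f i)).
have injA a b : F a = F b -> a = b.
  move=> Fab; apply/eqP; rewrite -subr_eq0; apply/eqP/injF.
  by rewrite rmorphB Fab subrr.
have iota0 k : (iota k != 0) = (k != 0).
  congr (~~ _); apply/eqP/eqP => [k0|->].
    by have := Fiota k; rewrite k0 rmorph0 => /esym/eqP; rewrite mpolyC_eq0 => /eqP.
  by apply: injF; rewrite Fiota mpolyC0.
have /negP[] : \sum_e iota (cf e) * \prod_(0 <= i < l.+1) f i ^+ e (inord i) != 0.
  apply: (prime_chain_independence (P := P) (a := fun e => iota (cf e))
    (e := fun (e : {ffun 'I_l.+1 -> 'I_N}) i => e (inord i))) => //.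
  - by split=> i il; [apply: primeP|apply: chainP]; apply: leq_trans il _.
  - move=> x y exy; apply/ffunP => i; apply: val_inj.
  by have := exy i (ltn_ord i); rewrite inord_val.
  - move=> x; rewrite iota0 => nz; exists (iota (cf x)^-1); apply: injA.
  by rewrite rmorphM !Fiota -mpolyCM mulVf // mpolyC1 rmorph1.
  - by exists e0; rewrite iota0.
apply/eqP/injF; rewrite rmorph_sum -[RHS]rel; apply: eq_bigr => e _.
rewrite rmorphM Fiota mul_mpolyC big_mkord rmorph_prod.
by congr (_ *: _); apply: eq_bigr => i _; rewrite rmorphXn inord_val.
Qed.

(** The element sent to ['X_[q] * ('X_i ^+ k - 1)] dies once ['X_i] is set to 1 but survives the
    earlier substitutions, so the kernels grow strictly. *)
Lemma krull_dim_subalgebra :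
  (forall i : 'I_l, exists a q k, (0 < k)%N /\ F a = 'X_[q] * ('X_i ^+ k - 1)) ->
  krull_dim A l.
Proof.
move=> bin; split; last exact: prime_chain_leq_vars.
pose h j : l.-tuple {mpoly K[l]} := [tuple if (i < j)%N then 1 else 'X_i | i < l].
pose Em j : {rmorphism A -> {mpoly K[l]}} := comp_mpoly (h j) \o F.
exists (fun j => [pred a | Em j a == 0] : {pred A}); split.
  by move=> j _; apply: prime_ideal_kernel.
have hX j m : 'X_[m] \mPo h j = 'X_[[multinom if (i < j)%N then 0%N else m i | i < l]].
  rewrite comp_mpolyX [RHS]mpolyXE_id; apply: eq_bigr => i _.
  by rewrite tnth_mktuple mnmE; case: ifP; rewrite ?expr1n ?expr0.
have hcomp j p : (p \mPo h j) \mPo h j.+1 = p \mPo h j.+1.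
  rewrite (mpolyE p) (raddf_sum (comp_mpoly (h j))).
  rewrite !(raddf_sum (comp_mpoly (h j.+1))); apply: eq_bigr => m _.
  rewrite /= !comp_mpolyZ !hX; congr (_ *: 'X_[_]); apply/mnmP => i.
  by rewrite !mnmE; case: ltnP => // /ltnW; rewrite leqNgt => /negPf->.
move=> j jl; split=> [a|sub].
  change (F a \mPo h j == 0 -> F a \mPo h j.+1 == 0) => /eqP Fa0.
  by rewrite -hcomp Fa0 comp_mpoly0.
have [a [q [k [k0 Fa]]]] := bin (Ordinal jl).
have hi j' : 'X_(Ordinal jl) \mPo h j' = if (j < j')%N then 1 else 'X_(Ordinal jl).
  by rewrite comp_mpolyXU -tnth_nth tnth_mktuple.
have Ea j' : Em j' a = ('X_[q] \mPo h j') * ((if (j < j')%N then 1 else 'X_(Ordinal jl)) ^+ k - 1).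
  by rewrite /= Fa rmorphM rmorphB rmorphXn rmorph1 /= hi.
have /sub : a \in [pred a | Em j.+1 a == 0] by rewrite inE Ea ltnSn expr1n subrr mulr0.
rewrite inE Ea ltnn mulf_eq0 hX; case/orP => /eqP/(congr1 (mcoeff _)).
  move/(_ [multinom (if (i < j)%N then 0%N else q i) | i < l])%MM.
  by rewrite mcoeffX eqxx mcoeff0 => /eqP; rewrite oner_eq0.
(* As [k > 0], the second factor has constant coefficient -1. *)
move/(_ 0%MM); rewrite mcoeffB mcoeffXn mcoeff1 mcoeff0 eqxx.
rewrite -mdeg_eq0 mdegMn mdeg1 mul1n eqn0Ngt k0 sub0r => /eqP.
by rewrite oppr_eq0 oner_eq0.
Qed.

End Subalgebras.

(** * Fiber rings of equigenerated monomial ideals *)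

Section HomogeneousParts.
Local Open Scope ring_scope.
Variables (n : nat) (R : nzRingType).
Implicit Types (f g : {mpoly R[n]}) (m : 'X_{1..n}).

Lemma mcoeff_pihomog d f m :
  (pihomog mdeg d f)@_m = if mdeg m == d then f@_m else 0.
Proof.
rewrite pihomogE [in LHS]raddf_sum /=; case: eqP => [md|md]; last first.
  apply: big1 => m' /eqP m'd; rewrite mcoeffZ mcoeffX.
  by case: eqP => [e|_]; [case: md; rewrite -e|rewrite mulr0].
rewrite [in RHS](mpolyE f) [in RHS]raddf_sum /=.
rewrite [RHS](bigID (fun m' => mdeg m' == d)) /= [X in _ + X]big1 ?addr0 //.
move=> m' m'd; rewrite mcoeffZ mcoeffX; case: eqP => [e|_]; last by rewrite mulr0.
by rewrite e md eqxx in m'd.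
Qed.

Lemma pihomog_eq0 d f : {in msupp f, forall m, mdeg m != d} -> pihomog mdeg d f = 0.
Proof.
move=> fd; apply/mpolyP => m; rewrite mcoeff_pihomog mcoeff0.
case: ifP => // md; apply: memN_msupp_eq0; apply/negP => /fd.
by rewrite md.
Qed.

Lemma msupp_pihomog d f m :
  (m \in msupp (pihomog mdeg d f)) = (mdeg m == d) && (m \in msupp f).
Proof.
by rewrite !mcoeff_msupp mcoeff_pihomog; case: ifP; rewrite ?eqxx.
Qed.

Lemma msupp_sub_pihomog d f m : m \in msupp (f - pihomog mdeg d f) ->
  mdeg m != d /\ m \in msupp f.
Proof.
rewrite !mcoeff_msupp mcoeffB mcoeff_pihomog; case: ifP; first by rewrite subrr eqxx.
by rewrite subr0.
Qed.

(** Under these bounds a product of two monomials has degree [a + b] only if the factors have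
    degrees exactly [a] and [b]. *)
Lemma pihomogM a b f g :
  {in msupp f, forall m, (a <= mdeg m)%N} ->
  {in msupp g, forall m, (b <= mdeg m)%N} ->
  pihomog mdeg (a + b) (f * g) = pihomog mdeg a f * pihomog mdeg b g.
Proof.
move=> fa gb; set fa' := pihomog mdeg a f; set gb' := pihomog mdeg b g.
have -> : f * g = fa' * gb' + (fa' * (g - gb') + (f - fa') * g).
  by rewrite addrA -mulrDr [gb' + _]addrC subrK -mulrDl [fa' + _]addrC subrK.
rewrite pihomogD pihomog_dE; last by apply: dhomogM; apply: pihomogP.
rewrite pihomog_eq0 ?addr0 // => m /msuppD_le; rewrite mem_cat.
case/orP=> /msuppM_le/allpairsP[[m1 m2] /= [m1s m2s ->]]; rewrite mdegD.
  move: m1s m2s; rewrite msupp_pihomog => /andP[/eqP-> _].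
  by move=> /msupp_sub_pihomog[m2b /gb]; lia.
by have [m1a /fa] := msupp_sub_pihomog m1s; have := gb _ m2s; lia.
Qed.

End HomogeneousParts.

(** * Powers of monomial ideals *)

Section Sumsets.
Local Open Scope ring_scope.
Variable n : nat.
Implicit Types (A : set 'X_{1..n}) (m : 'X_{1..n}).

Fixpoint sumset A k : set 'X_{1..n} :=
  if k is k'.+1 then [set m | exists a b, [/\ A a, sumset A k' b & m = (a + b)%MM]]%classic
  else [set 0%MM]%classic.

Lemma sumsetD A j k a b : sumset A j a -> sumset A k b -> sumset A (j + k) (a + b)%MM.
Proof.
move=> + kb; elim: j a => [_ ->|j IH _ [c [e [Ac je ->]]]]; first by rewrite add0m.
by exists c, (e + b)%MM; rewrite addmA; split=> //; apply: IH.
Qed.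

Lemma sumset1 A a : A a -> sumset A 1 a.
Proof. by move=> Aa; exists a, 0%MM; rewrite addm0. Qed.

Lemma sumsetMn A k e a : sumset A k a -> sumset A (k * e) (a *+ e)%MM.
Proof.
move=> Aa; elim: e => [|e IH]; first by rewrite muln0 mulm0n.
by rewrite mulmS mulnS; apply: sumsetD.
Qed.

Lemma mdeg_sumset A d : (forall a, A a -> mdeg a = d) ->
  forall k m, sumset A k m -> mdeg m = (d * k)%N.
Proof.
move=> Ad; elim=> [_ ->|k IH _ [a [b [/Ad ad /IH bd ->]]]]; first by rewrite mdeg0 muln0.
by rewrite mdegD ad bd mulnS.
Qed.

Variable K : fieldType.

Lemma ideal_mul_mono A B :
  ideal_mul (@mono_ideal _ K A) (@mono_ideal _ K B) =
  @mono_ideal _ K [set m | exists a b, [/\ A a, B b & m = (a + b)%MM]]%classic.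
Proof.
apply/seteqP; split=> f.
  apply: (ideal_gen_min (@mono_ideal _ K _)); [exact: ideal_gen0|exact: ideal_genD|
    exact: ideal_genMl|].
  move=> _ [g [h [/mono_idealP gA /mono_idealP hB ->]]].
  apply/mono_idealP => m /msuppM_le/allpairsP[[m1 m2] /= [/gA[a Aa am] /hB[b Bb bm] ->]].
  by exists (a + b)%MM; [exists a, b|apply/mnm_lepP => i; rewrite !mnmDE leq_add // (mnm_lepP _)].
apply: (ideal_gen_min (ideal_mul _ _)); [exact: ideal_gen0|exact: ideal_genD|
  exact: ideal_genMl|].
move=> _ [_ [a [b [Aa Bb ->]]] ->]; rewrite mpolyXD.
by apply: ideal_mul_in; apply: ideal_gen_in; [exists a|exists b].
Qed.

Lemma ideal_exp_mono A k : ideal_exp (@mono_ideal _ K A) k = @mono_ideal _ K (sumset A k).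
Proof.
elim: k => [|k IH] /=; last by rewrite IH ideal_mul_mono.
apply/seteqP; split=> f // _; apply/mono_idealP => m _.
by exists 0%MM => //; apply/mnm_lepP => i; rewrite mnm0E.
Qed.

End Sumsets.

(** * Restriction to some of the variables *)

Section Restriction.
Local Open Scope ring_scope.
Variables (K : fieldType) (n l : nat) (tau : 'I_l -> 'I_n).

Definition restrict_mnm (m : 'X_{1..n}) : 'X_{1..l} := [multinom m (tau j) | j < l].

(** For injective [tau] the variable of index [tau j] goes to ['X_j]; a variable outside the image
    of [tau] goes to 1, the empty product. *)
Definition restrict_vars : n.-tuple {mpoly K[l]} :=
  [tuple \prod_(j | tau j == i) 'X_j | i < n].

Lemma comp_restrictX m : 'X_[m] \mPo restrict_vars = 'X_[restrict_mnm m].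
Proof.
rewrite comp_mpolyX [RHS]mpolyXE_id (partition_big tau predT) //=.
apply: eq_bigr => i _; rewrite tnth_mktuple -prodrXl.
by apply: eq_bigr => j /eqP <-; rewrite mnmE.
Qed.

Lemma comp_restrict_inj (f : {mpoly K[n]}) :
  {in msupp f &, injective restrict_mnm} -> f \mPo restrict_vars = 0 -> f = 0.
Proof.
move=> inj f0; apply/mpolyP => m; rewrite mcoeff0.
have [mf|] := boolP (m \in msupp f); last exact: memN_msupp_eq0.
have := congr1 (mcoeff (restrict_mnm m)) f0.
rewrite comp_mpolyEX mcoeff0 raddf_sum (bigD1_seq m) ?msupp_uniq //= big_seq_cond.
rewrite big1 ?addr0; first by rewrite comp_restrictX mcoeffZ mcoeffX eqxx mulr1.
move=> m' /andP[m'f neq]; rewrite comp_restrictX mcoeffZ mcoeffX.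
by case: eqP => [/(inj _ _ m'f mf) e|_]; [rewrite e eqxx in neq|rewrite mulr0].
Qed.

End Restriction.

(** * The fiber ring as a subalgebra of a polynomial ring *)

Section FiberRingSpread.
Local Open Scope ring_scope.
Local Open Scope quotient_scope.
Variables (n : nat) (K : fieldType) (d : nat) (A : set 'X_{1..n}).
Hypotheses (d_gt0 : (0 < d)%N) (degA : forall a, A a -> mdeg a = d).

Let I : set {mpoly K[n]} := mono_ideal A.

(** Monomials in [I^k] have degree at least [d * k], those in [m I^k] a larger one. Keeping degree
    [d * k] in the [k]-th coefficient is thus reduction modulo the ideal that defines the fiber
    ring. *)
Definition bottom_poly (p : {poly {mpoly K[n]}}) : {poly {mpoly K[n]}} :=
  \poly_(k < size p) pihomog mdeg (d * k) p`_k.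

Definition bottom_form (p : {poly {mpoly K[n]}}) : {mpoly K[n]} := (bottom_poly p).[1].

Lemma coef_bottom_poly p k : (bottom_poly p)`_k = pihomog mdeg (d * k) p`_k.
Proof.
rewrite coef_poly; case: ltnP => // pk.
by rewrite nth_default // pihomog0.
Qed.

Lemma ideal_exp_supp k f : ideal_exp I k f ->
  {in msupp f, forall m, (d * k <= mdeg m)%N /\ (mdeg m = d * k -> sumset A k m)%N}.
Proof.
rewrite ideal_exp_mono => /mono_idealP h m /h[a Aa am].
have da := mdeg_sumset degA Aa.
have e : mdeg m = (mdeg (m - a) + d * k)%N by rewrite -da -mdegD submK.
split=> [|dm]; first by rewrite e leq_addl.
have /eqP : mdeg (m - a) = 0%N by lia.
by rewrite mdeg_eq0 => /eqP m0; rewrite -(submK am) m0 add0m.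
Qed.

Lemma bottom_formD p q : bottom_form (p + q) = bottom_form p + bottom_form q.
Proof.
rewrite /bottom_form -hornerD; congr (_.[1]); apply/polyP => k.
by rewrite coefD !coef_bottom_poly coefD pihomogD.
Qed.

Lemma bottom_formM (p q : rees I) :
  bottom_form (val p * val q) = bottom_form (val p) * bottom_form (val q).
Proof.
case: p q => [p Ip] [q Iq] /=; move/rees_predP: Ip => Ip; move/rees_predP: Iq => Iq.
rewrite /bottom_form -hornerM; congr (_.[1]); apply/polyP => k.
rewrite coefM coef_bottom_poly coefM raddf_sum; apply: eq_bigr => -[i /= ik] _.
rewrite !coef_bottom_poly -{1}(@subnKC i k) // mulnDr pihomogM //.
  by move=> m /(ideal_exp_supp (Ip i))[].
by move=> m /(ideal_exp_supp (Iq _))[].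
Qed.

Lemma bottom_formE p : bottom_form p = \sum_(k < size p) pihomog mdeg (d * k) p`_k.
Proof.
rewrite /bottom_form (@horner_coef_wide _ (size p)) ?size_poly //.
by apply: eq_bigr => k _; rewrite expr1n mulr1 coef_bottom_poly.
Qed.

(** Since [d > 0], the degree [d * k] determines [k], so evaluating at 1 in [bottom_form] loses
    nothing. *)
Lemma pihomog_bottom_form p k :
  pihomog mdeg (d * k) (bottom_form p) = pihomog mdeg (d * k) p`_k.
Proof.
rewrite bottom_formE raddf_sum /=.
have [kp|pk] := ltnP k (size p).
  rewrite (bigD1 (Ordinal kp)) //= pihomog_id big1 ?addr0 // => i ik.
  apply: (@pihomog_ne0 _ _ _ (d * i)); last exact: pihomogP.
  by rewrite eqn_pmul2l.
rewrite nth_default // pihomog0 big1 // => i _.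
apply: (@pihomog_ne0 _ _ _ (d * i)); last exact: pihomogP.
by rewrite eqn_pmul2l // neq_ltn (leq_trans (ltn_ord i) pk).
Qed.

Lemma msupp_bottom_form (p : rees I) m :
  m \in msupp (bottom_form (val p)) -> exists k, sumset A k m.
Proof.
case: p => p /= /rees_predP Ip; rewrite bottom_formE => /msupp_sum_le/flatten_mapP[k _].
by rewrite msupp_pihomog => /andP[/eqP dm /(ideal_exp_supp (Ip k))[_ /(_ dm)]]; exists k.
Qed.

Lemma irrelevant_X (m : 'X_{1..n}) : m != 0%MM -> irrelevant_ideal ('X_[m] : {mpoly K[n]}).
Proof.
move=> m0; have [i mi] : exists i, m i != 0%N.
  by apply/existsP; apply: contraR m0 => /existsPn h; apply/eqP/mnmP => i;
     rewrite mnm0E; apply/eqP; move: (h i); rewrite negbK.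
have im : (U_(i) <= m)%MM by apply/mnm_lepP => j; rewrite mnm1E; case: eqP => // <-; lia.
rewrite -(submK im) mpolyXD; apply: ideal_genMl; apply: ideal_gen_in; by exists i.
Qed.

Lemma bottom_form_eq0 (p : rees I) : bottom_form (val p) = 0 <-> p \in fiber_pred I.
Proof.
have Ip : forall k, ideal_exp I k (val p)`_k by case: (p) => q /= /rees_predP.
split=> [p0|/fiber_predP mp].
  apply/fiber_predP => k.
  have pk0 : pihomog mdeg (d * k) (val p)`_k = 0 by rewrite -pihomog_bottom_form p0 pihomog0.
  rewrite (mpolyE (val p)`_k) big_seq; apply: ideal_gen_sum => m mp.
  have [_ mk] := ideal_exp_supp (Ip k) mp.
  have /mono_idealP/(_ m mp)[a Aa am] : mono_ideal (sumset A k) (val p)`_k.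
    by rewrite -ideal_exp_mono.
  rewrite -mul_mpolyC; apply: ideal_genMl; rewrite -(submK am) mpolyXD.
  apply: ideal_mul_in; last by rewrite ideal_exp_mono; apply: ideal_gen_in; exists a.
  (* Were the cofactor of [a] trivial, [m] would have degree [d * k] and survive in the bottom
     form. *)
  apply: irrelevant_X; apply/eqP => ma0.
  have : m \in msupp (pihomog mdeg (d * k) (val p)`_k).
    by rewrite msupp_pihomog mp -(submK am) ma0 add0m (mdeg_sumset degA Aa) eqxx.
  by rewrite pk0 msupp0.
rewrite bottom_formE big1 // => k _; apply: pihomog_eq0.
(* A factor in [irrelevant_ideal] has no constant term, which pushes the degrees strictly above
   [d * k]. *)
suff gt : {in msupp (val p)`_k, forall m, (d * k < mdeg m)%N}.
  by move=> m /gt; rewrite ltn_neqAle eq_sym => /andP[].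
move: (mp k); move: (_`_k) => f; move: f.
apply: (ideal_gen_min
  [set f : {mpoly K[n]} | {in msupp f, forall m, (d * k < mdeg m)%N}]%classic) => /=.
- by move=> m; rewrite msupp0.
- by move=> f g hf hg m /msuppD_le; rewrite mem_cat => /orP[/hf|/hg].
- move=> a f hf m /msuppM_le/allpairsP[[m1 m2] /= [_ /hf m2d ->]].
  by rewrite mdegD (leq_trans m2d) ?leq_addl.
move=> _ [f [g [/irrelevant_coef0 f0 Ig ->]]] m /msuppM_le.
move=> /allpairsP[[m1 m2] /= [m1f /(ideal_exp_supp Ig)[m2d _] ->]].
rewrite mdegD -add1n leq_add // lt0n mdeg_eq0.
by apply: contraL m1f => /eqP->; rewrite mcoeff_msupp f0 eqxx.
Qed.

Variables (l : nat) (tau : 'I_l -> 'I_n).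

(** Defined through a chosen representative; [fiber_map_pi] shows independence of the choice. *)
Definition fiber_map (x : fiber_ring I) : {mpoly K[l]} :=
  bottom_form (val (repr x)) \mPo restrict_vars K tau.

Lemma bottom_formN p : bottom_form (- p) = - bottom_form p.
Proof.
apply/eqP; rewrite -subr_eq0 opprK -bottom_formD addNr.
by rewrite bottom_formE size_poly0 big_ord0.
Qed.

Lemma fiber_map_pi (p : rees I) :
  fiber_map (\pi_(fiber_ring I) p) = bottom_form (val p) \mPo restrict_vars K tau.
Proof.
rewrite /fiber_map; congr (_ \mPo _); apply/eqP; rewrite -subr_eq0; apply/eqP.
have : repr (\pi_(fiber_ring I) p) - p \in fiber_pred I.
  by rewrite Quotient.idealrBE reprK.
by move/bottom_form_eq0; rewrite rmorphB /= bottom_formD bottom_formN.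
Qed.

Lemma fiber_map_zmod_morphism : zmod_morphism fiber_map.
Proof.
move=> x y; rewrite -(reprK x) -(reprK y) -rmorphB !fiber_map_pi.
by rewrite rmorphB /= bottom_formD bottom_formN comp_mpolyB.
Qed.

Lemma fiber_map_monoid_morphism : monoid_morphism fiber_map.
Proof.
split=> [|x y].
  rewrite -(rmorph1 (\pi_(fiber_ring I))) fiber_map_pi rmorph1.
  rewrite bottom_formE size_poly1 big_ord1 muln0 coef1 eqxx pihomog_dE ?comp_mpoly1 //.
  exact: dhomog1.
rewrite -(reprK x) -(reprK y) -rmorphM !fiber_map_pi.
by rewrite rmorphM bottom_formM rmorphM.
Qed.

HB.instance Definition _ := GRing.isZmodMorphism.Build (fiber_ring I) {mpoly K[l]}
  fiber_map fiber_map_zmod_morphism.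
HB.instance Definition _ := GRing.isMonoidMorphism.Build (fiber_ring I) {mpoly K[l]}
  fiber_map fiber_map_monoid_morphism.

Lemma fiber_map_monomial k (f : {mpoly K[n]}) : ideal_exp I k f ->
  exists x, fiber_map x = pihomog mdeg (d * k) f \mPo restrict_vars K tau.
Proof.
move=> If; have Rp : f *: 'X^k \in rees_pred I.
  apply/rees_predP => j; rewrite coefZ coefXn.
  by case: eqP => [->|_]; rewrite ?mulr1 // mulr0; apply: ideal_exp0.
exists (\pi_(fiber_ring I) (Rees Rp)); rewrite fiber_map_pi; congr (_ \mPo _).
have bX : bottom_poly (f *: 'X^k) = pihomog mdeg (d * k) f *: 'X^k.
  apply/polyP => j; rewrite coef_bottom_poly coefZ [RHS]coefZ coefXn.
  by case: eqP => [->|_]; rewrite ?mulr1 // !mulr0 pihomog0.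
by rewrite /bottom_form bX hornerZ hornerXn expr1n mulr1.
Qed.

(** The first hypothesis rules out cancellation, making the fiber map injective. The second yields
    the binomials for [krull_dim_subalgebra] as differences of classes of monomials; [p] and [q] may
    come from different powers. *)
Lemma analytic_spread_mono :
  (forall k k' v v', sumset A k v -> sumset A k' v' ->
     restrict_mnm tau v = restrict_mnm tau v' -> v = v') ->
  (forall i : 'I_l, exists p q e, [/\ (0 < e)%N, exists k, sumset A k p,
     exists k, sumset A k q & restrict_mnm tau p = (restrict_mnm tau q + U_(i) *+ e)%MM]) ->
  analytic_spread I l.
Proof.
move=> inj dir; apply: (@krull_dim_subalgebra _ _ _ fiber_map).
- move=> x x0.
  have /bottom_form_eq0 : bottom_form (val (repr x)) = 0.
    apply: comp_restrict_inj x0 => v v' /msupp_bottom_form[k kv] /msupp_bottom_form[k' kv'].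
    exact: inj kv kv'.
  rewrite -[repr x]subr0 Quotient.idealrBE => /eqP e.
  by apply: etrans (esym (reprK x)) _; apply: etrans e _; apply: raddf0.
- move=> c; have [x Fx] := @fiber_map_monomial 0 c%:MP Logic.I.
  exists x; apply: etrans Fx _; rewrite muln0 pihomog_dE ?comp_mpolyC //.
  apply/dhomogP => m; rewrite msuppC; case: eqP => // _.
  by rewrite inE => /eqP ->; apply: mdeg0.
move=> i; have [p [q [e [e0 [kp Ap] [kq Aq] pq]]]] := dir i.
have mono k v : sumset A k v -> exists x, fiber_map x = 'X_[restrict_mnm tau v].
  move=> Av; have [|x Fx] := @fiber_map_monomial k 'X_[v].
    by rewrite ideal_exp_mono; apply: ideal_gen_in; exists v.
  exists x; rewrite Fx pihomogX ifT; first exact: comp_restrictX.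
  by apply/eqP; apply: mdeg_sumset Av.
have [x Fx] := mono _ _ Ap; have [y Fy] := mono _ _ Aq.
exists (x - y), (restrict_mnm tau q), e; split=> //.
apply: etrans (rmorphB _ _ _) _; rewrite mulrBr mulr1 mpolyXn -mpolyXD -pq.
by congr (_ - _).
Qed.

End FiberRingSpread.

(** * The Borel order *)

Section BorelOrder.
Variable n : nat.
Implicit Types (m u v w : 'X_{1..n}) (i j : 'I_n) (k : nat).

Definition prefix_deg m k := \sum_(i < n | i < k) m i.

Lemma prefix_deg0 m : prefix_deg m 0 = 0.
Proof. by rewrite /prefix_deg big_pred0. Qed.

Lemma prefix_degS m i : prefix_deg m i.+1 = prefix_deg m i + m i.
Proof.
rewrite /prefix_deg (bigD1 i) //= addnC; congr (_ + _); apply: eq_bigl => j.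
by rewrite ltnS andbC ltn_neqAle.
Qed.

Lemma prefix_deg_mono m : {homo prefix_deg m : k k' / k <= k'}.
Proof.
move=> k k' kk'; rewrite /prefix_deg [leqRHS](bigID (fun i : 'I_n => i < k)) /=.
rewrite [X in _ <= X + _](eq_bigl (fun i : 'I_n => i < k)) ?leq_addr // => i.
by rewrite andb_idl // => /leq_trans; apply.
Qed.

Lemma prefix_deg_all m k : n <= k -> prefix_deg m k = mdeg m.
Proof.
by move=> nk; rewrite /prefix_deg mdegE; apply: eq_bigl => i; rewrite (leq_trans _ nk).
Qed.

Lemma prefix_deg_le m k : prefix_deg m k <= mdeg m.
Proof. by rewrite /prefix_deg mdegE [leqRHS](bigID (fun i : 'I_n => i < k)) leq_addr. Qed.

Lemma prefix_degD m m' k : prefix_deg (m + m')%MM k = prefix_deg m k + prefix_deg m' k.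
Proof. by rewrite /prefix_deg -big_split; apply: eq_bigr => i _; rewrite mnmDE. Qed.

Lemma prefix_deg1 i k : prefix_deg U_(i)%MM k = (i < k).
Proof.
rewrite /prefix_deg big_mkcond (bigD1 i) //= big1 ?addn0 => [|j ji].
  by rewrite mnm1E eqxx; case: ifP.
by rewrite mnm1E eq_sym (negPf ji); case: ifP.
Qed.

Lemma prefix_degMn m e k : prefix_deg (m *+ e)%MM k = prefix_deg m k * e.
Proof.
elim: e => [|e IH]; first by rewrite mulm0n muln0 /prefix_deg big1 // => i _; rewrite mnm0E.
by rewrite mulmS prefix_degD IH mulnS.
Qed.

Lemma prefix_deg_inj m m' : (forall k, prefix_deg m k = prefix_deg m' k) -> m = m'.
Proof.
move=> e; apply/mnmP => i; have := e i.+1.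
by rewrite !prefix_degS e => /addnI.
Qed.

(** The exponents are the successive differences of [W]; prefix sums are constant beyond [n], whence
    [minn]. *)
Lemma mnm_of_prefix (W : nat -> nat) : W 0 = 0 -> {homo W : k k' / k <= k'} ->
  exists m : 'X_{1..n}, forall k, prefix_deg m k = W (minn k n).
Proof.
move=> W0 Wm; exists [multinom W i.+1 - W i | i < n]; elim=> [|k IH].
  by rewrite prefix_deg0 min0n W0.
have [kn|nk] := ltnP k n.
  rewrite (prefix_degS _ (Ordinal kn)) /= IH mnmE /=.
  rewrite (minn_idPl (ltnW kn)) (minn_idPl kn) subnKC //; exact: Wm.
by rewrite (minn_idPr (leqW nk)) prefix_deg_all ?leqW // -(prefix_deg_all _ nk) IH (minn_idPr nk).
Qed.

(** The dominance order on exponent vectors, oriented so that Borel moves go down: they raise prefix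
    sums. *)
Definition borel_le v u : Prop :=
  mdeg v = mdeg u /\ forall k, prefix_deg u k <= prefix_deg v k.

(** The correction for [j] stands on the left to avoid truncated subtraction. *)
Lemma prefix_deg_shift m i j k : 0 < m j ->
  prefix_deg (mnm_shift m i j) k + (j < k) = prefix_deg m k + (i < k).
Proof.
move=> mj; rewrite /mnm_shift prefix_degD prefix_deg1 addnAC; congr (_ + _).
rewrite -prefix_deg1 -prefix_degD submK //.
by apply/mnm_lepP => l; rewrite mnm1E; case: eqP => // <-.
Qed.

Lemma borel_le_shift u v i j : 0 < v j -> i < j -> borel_le v u ->
  borel_le (mnm_shift v i j) u.
Proof.
move=> vj ij [dv pv]; have sh k := prefix_deg_shift i k vj; split.
  have := sh n; rewrite !prefix_deg_all // !ltn_ord dv; exact: addIn.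
move=> k; apply: leq_trans (pv k) _; move: (sh k); lia.
Qed.

Lemma mnm_shiftE m i j l : mnm_shift m i j l = m l - (j == l) + (i == l).
Proof. by rewrite /mnm_shift mnmDE mnmBE !mnm1E. Qed.

(* Moving one variable of [v] from [i] up to the first later [j] at which [v] falls short
   of [u] stays below [u]: between [i] and [j] the prefix sums of [v] strictly
   exceed those of [u]. *)
Lemma borel_le_up u v : borel_le v u -> v <> u ->
  exists i j, [/\ i < j, u i < v i, v j < u j & borel_le (mnm_shift v j i) u].
Proof.
move=> [dv pv] vu.
have [i ui] : exists i, u i < v i.
  apply/existsP; apply: contra_notT vu => /existsPn h; apply/mnmP => i; apply/eqP.
  have le (j : 'I_n) : v j <= u j by rewrite leqNgt.
  move: dv; rewrite !mdegE => /eqP; rewrite (leqif_sum (fun (j : 'I_n) _ => leqif_eq (le j))).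
  by move/forallP/(_ i).
have [j [ij vj minj]] : exists j, [/\ i < j, v j < u j &
    forall j' : 'I_n, i < j' < j -> u j' <= v j'].
  (* Without such a [j] the excess gained at [i] would persist up to [n], against equal degrees. *)
  have [j0 /andP[ij0 vj0]] : exists j, (i < j) && (v j < u j).
    apply/existsP; apply: contraT => /existsPn h.
    suff : prefix_deg u n < prefix_deg v n by rewrite !prefix_deg_all // dv ltnn.
    have : forall k, i < k -> k <= n -> prefix_deg u k < prefix_deg v k.
      elim=> // k IH; rewrite ltnS leq_eqVlt => /orP[/eqP<- _|ik kn].
        by rewrite !prefix_degS; have := pv i; lia.
      rewrite !(prefix_degS _ (Ordinal kn)); have := IH ik (ltnW kn).
      by have := h (Ordinal kn); rewrite /= ik /=; lia.
    by apply.
  case: (arg_minnP (fun j : 'I_n => j : nat) (i0 := j0) (P := fun j => (i < j) && (v j < u j))).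
    by rewrite ij0.
  move=> j /andP[ij vj] minj; exists j; split=> // j' /andP[ij' j'j].
  by rewrite leqNgt; apply/negP => vj'; have := minj j'; rewrite ij' vj' => /(_ isT); lia.
have gt : forall k, i < k -> k <= j -> prefix_deg u k < prefix_deg v k.
  elim=> // k IH; rewrite ltnS leq_eqVlt => /orP[/eqP<- _|ik kj].
    by rewrite !prefix_degS; have := pv i; lia.
  have kn := ltn_trans kj (ltn_ord j).
  rewrite !(prefix_degS _ (Ordinal kn)); have := IH ik (ltnW kj).
  by have := minj (Ordinal kn); rewrite /= ik kj => /(_ isT); lia.
have vi : 0 < v i by apply: leq_ltn_trans ui.
exists i, j; split=> //; split.
  by have := prefix_deg_shift j n vi; rewrite !prefix_deg_all // !ltn_ord -dv; lia.
move=> k; have := prefix_deg_shift j k vi; have := pv k; have := gt k; lia.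
Qed.

(** The upward move of [borel_le_up] lowers the sum of the truncated differences [v i - u i], and it
    respects the bound because the raised exponent stays at most that of [u]. *)
Lemma borel_le_ind k u (Q : 'X_{1..n} -> Prop) : bounded k u -> Q u ->
  (forall v i j, bounded k v -> Q v -> 0 < v j -> i < j ->
     bounded k (mnm_shift v i j) -> Q (mnm_shift v i j)) ->
  forall v, borel_le v u -> bounded k v -> Q v.
Proof.
move=> bu Qu step v; have [N] := ubnP (\sum_i (v i - u i)).
elim: N v => // N IH v vN vu bv.
have [->//|/eqP neq] := eqVneq v u.
have [i [j [ij ui vj v'u]]] := borel_le_up vu neq.
pose v' := mnm_shift v j i.
have v'E l : v' l = v l - (i == l) + (j == l) by exact: mnm_shiftE.
have neij : i != j by rewrite -(inj_eq val_inj) /= neq_ltn ij.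
have v'j : v' j = (v j).+1 by rewrite v'E (negPf neij) eqxx; lia.
have vE : v = mnm_shift v' i j.
  apply/mnmP => l; rewrite mnm_shiftE v'E; move: neij.
  by have [<-|_] := eqVneq i l; have [e|_] := eqVneq j l; rewrite ?eqxx //; lia.
have bv' : bounded k v'.
  move=> l; have := bv l; have := bu l; rewrite v'E.
  by have [<-|_] := eqVneq j l; lia.
rewrite vE; apply: step => //; first apply: IH => //.
- rewrite ltnS in vN; apply: leq_trans vN; rewrite (bigD1 i) // [X in _ < X](bigD1 i) //= -addSn.
  apply: leq_add; first by rewrite v'E eqxx eq_sym (negPf neij); lia.
  apply: leq_sum => l li; rewrite v'E eq_sym (negPf li).
  by have [<-|_] := eqVneq j l; lia.
- by rewrite v'j.
- by rewrite -vE.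
Qed.

(** One definition serves both ideals: [k := mdeg u] gives the generators of B(u), a smaller bound
    those of B_k(u). *)
Definition borel_set k u : set 'X_{1..n} := [set v | borel_le v u /\ bounded k v]%classic.

Lemma bounded_mdeg m k : mdeg m <= k -> bounded k m.
Proof. by move=> dm i; apply: leq_trans dm; rewrite mdegE (bigD1 i) //= leq_addr. Qed.

(* Dealing out the variables of [w], listed in increasing order, alternately to
   two monomials amounts to halving the prefix sums. *)
Lemma sumset2_borel_set k u : sumset (borel_set k u) 2 = borel_set k.*2 (u + u)%MM.
Proof.
apply/seteqP; split=> w.
  move=> [a [_ [[[da pa] ba] [b [_ [[[db pb] bb] -> ->]]] ->]]]; rewrite addm0.
  split; last by move=> i; rewrite mnmDE -addnn leq_add.
  split=> [|j]; first by rewrite !mdegD da db.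
  by rewrite !prefix_degD leq_add.
move=> [[dw pw] bw].
have [|k1 k2 le12|a aE] := @mnm_of_prefix (fun k => uphalf (prefix_deg w k)).
- by rewrite prefix_deg0.
- by rewrite uphalf_leq // prefix_deg_mono.
have [|k1 k2 le12|b bE] := @mnm_of_prefix (fun k => (prefix_deg w k)./2).
- by rewrite prefix_deg0.
- by rewrite half_leq // prefix_deg_mono.
have wmin (j : nat) : prefix_deg w (minn j n) = prefix_deg w j.
  have [//|nj] := leqP j n.
  by rewrite !prefix_deg_all // ltnW.
have a' (j : nat) : prefix_deg a j = uphalf (prefix_deg w j) by rewrite aE wmin.
have b' (j : nat) : prefix_deg b j = (prefix_deg w j)./2 by rewrite bE wmin.
have p2 (j : nat) : (prefix_deg u j).*2 <= prefix_deg w j by have := pw j; rewrite prefix_degD addnn.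
have dw2 : prefix_deg w n = (mdeg u).*2 by rewrite prefix_deg_all // dw mdegD addnn.
exists a, (b + 0)%MM; split.
- split; [split|].
  + rewrite -(prefix_deg_all a (leqnn n)) a' dw2; lia.
  + by move=> j; rewrite a'; have := p2 j; lia.
  (* An exponent of [w] at most [2k] changes a rounded half of the prefix sum by at most [k]. *)
  by move=> i; have := prefix_degS a i; rewrite !a' prefix_degS; have := bw i; lia.
- exists b, 0%MM; split=> //; split; [split|].
  + by rewrite -(prefix_deg_all b (leqnn n)) b' dw2 doubleK.
  + by move=> j; rewrite b'; have := p2 j; lia.
  by move=> i; have := prefix_degS b i; rewrite !b' prefix_degS; have := bw i; lia.
by apply: prefix_deg_inj => j; rewrite addm0 prefix_degD a' b'; lia.
Qed.

End BorelOrder.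

(** * Generators of principal Borel ideals *)

Section PrincipalBorel.
Variables (n : nat) (K : fieldType).
Implicit Types (u v m : 'X_{1..n}) (A : set 'X_{1..n}).

Lemma lepm_mdeg_eq m m' : (m <= m')%MM -> mdeg m = mdeg m' -> m = m'.
Proof.
move=> le e; have : mdeg (m' - m) + mdeg m = mdeg m' by rewrite -mdegD submK.
move=> e'; have /eqP : mdeg (m' - m) = 0 by lia.
by rewrite mdeg_eq0 => /eqP d0; rewrite -(submK le) d0 add0m.
Qed.

(** Distinct monomials of equal degree do not divide each other, so every monomial generating set
    contains [A]. *)
Lemma mingens_mono A d : (forall a, A a -> mdeg a = d) ->
  mingens (@mono_ideal _ K A) = A.
Proof.
move=> Ad; apply/seteqP; split=> m; first by apply.
move=> Am B AB.
have /mono_idealX[b Bb bm] : @mono_ideal _ K B 'X_[m].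
  by rewrite -AB; apply: ideal_gen_in; exists m.
have /mono_idealX[a Aa ab] : @mono_ideal _ K A 'X_[b].
  by rewrite AB; apply: ideal_gen_in; exists b.
have am : a = m by apply: (lepm_mdeg_eq (lepm_trans ab bm)); rewrite !Ad.
suff <- : b = m by [].
apply/mnmP => i; apply/eqP; rewrite eqn_leq (mnm_lepP bm) /= -am.
exact: (mnm_lepP ab).
Qed.

Lemma freiman_mono A d l : (forall a, A a -> mdeg a = d) ->
  analytic_spread (@mono_ideal _ K A) l ->
  freiman (@mono_ideal _ K A) <->
  (#|` fset_set (sumset A 2)|%fset%:Z =
     l%:Z * #|` fset_set A|%fset%:Z - ('C(l, 2))%:Z)%R.
Proof.
move=> Ad spl; rewrite /freiman /mu ideal_exp_mono (mingens_mono Ad).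
rewrite (mingens_mono (mdeg_sumset Ad (k := 2))).
split=> [[_ _ [l' spl' ]]|e]; first by rewrite (krull_dim_unique spl spl').
by split; [exists A|exists d; rewrite (mingens_mono Ad)|exists l].
Qed.

Lemma borel_set_deg k u v : borel_set k u v -> mdeg v = mdeg u.
Proof. by case=> [[]]. Qed.

Lemma principal_kborelE k u : bounded k u ->
  principal_kborel K k u = mono_ideal (borel_set k u).
Proof.
move=> bu; have [[[A _ EA] shift] uI least] := principal_kborel_least K k u.
apply/seteqP; split; last first.
  apply: ideal_gen_min; rewrite ?EA; [exact: ideal_gen0|exact: ideal_genD|
    exact: ideal_genMl|].
  rewrite -EA => _ [v [vu bv] ->]; move: v vu bv.
  by apply: borel_le_ind => // v i j bv Iv vj ij bs; apply: shift.
apply: least; last by apply: ideal_gen_in; exists u.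
split; first by exists (borel_set k u) => // v [].
move=> m i j bm /mono_idealX[a [au ba] am] mj ij bs; apply/mono_idealX.
have ale l := mnm_lepP am l.
(* If [m] has [x_j] to spare over its divisor [a], then [a] divides the shift of [m]; otherwise the
   shift of [a] does. *)
have [aj|aj] := ltnP (a j) (m j).
  exists a => //; apply/mnm_lepP => l; rewrite mnm_shiftE; have := ale l.
  by have [<-|_] := eqVneq j l; lia.
have aj0 : 0 < a j by apply: leq_trans aj.
have le l : mnm_shift a i j l <= mnm_shift m i j l.
  by rewrite !mnm_shiftE leq_add2r leq_sub2r.
exists (mnm_shift a i j); last exact/mnm_lepP.
by split=> [|l]; [apply: borel_le_shift|apply: leq_trans (bs l)].
Qed.

Lemma principal_borelE u : principal_borel K u = mono_ideal (borel_set (mdeg u) u).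
Proof.
have [[[A EA] _] uI least] := principal_borel_least K u.
have bB : borel (principal_borel K u) by case: (principal_borel_least K u).
have bu : bounded (mdeg u) u by apply: bounded_mdeg.
apply/seteqP; split; last first.
  apply: ideal_gen_min; rewrite ?EA; [exact: ideal_gen0|exact: ideal_genD|
    exact: ideal_genMl|].
  rewrite -EA => _ [v [vu bv] ->]; move: v vu bv.
  by apply: borel_le_ind => // v i j bv Iv vj ij bs; apply: borel_all.
apply: least; last by apply: ideal_gen_in; exists u.
split; first by exists (borel_set (mdeg u) u).
move=> m i j; rewrite (mingens_mono (borel_set_deg (k := _) (u := _))) => -[mu' bm] mj ij.
apply: ideal_gen_in; exists (mnm_shift m i j) => //.
have su := borel_le_shift mj ij mu'.
by split=> //; apply: bounded_mdeg; rewrite (proj1 su).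
Qed.

End PrincipalBorel.

(** * Cardinalities and nearly pure monomials *)

Section Counting.
Local Open Scope classical_set_scope.

Lemma finite_mdeg n (A : set 'X_{1..n}) d : (forall a, A a -> mdeg a = d) -> finite_set A.
Proof.
move=> Ad; apply: (@sub_finite_set _ _ (range (fun m : 'X_{1..n < d.+1} => bmnm m))).
  move=> a /Ad ad; have lt : mdeg a < d.+1 by rewrite ad.
  by exists (BMultinom lt).
exact: finite_image.
Qed.

Lemma card_setU_range (T : choiceType) (I : finType) (A : set T) (f : I -> T) :
  finite_set A -> injective f -> (forall i, ~ A (f i)) ->
  #|` fset_set (A `|` range f)|%fset = #|` fset_set A|%fset + #|I|.
Proof.
move=> fA inj Af; rewrite fset_setU //; last exact: finite_image.
rewrite cardfsU.
have -> : (fset_set A `&` fset_set (range f))%fset = fset0.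
  apply/fsetP => x; rewrite inE !in_fset_set ?in_fset0 //; last exact: finite_image.
  apply/negP => /andP[/set_mem Ax /set_mem [i _ fi]].
  by apply: (Af i); rewrite fi.
rewrite cardfs0 subn0; congr (_ + _).
have -> : fset_set (range f) = [fset f i | i in I]%fset.
  apply/fsetP => x; rewrite in_fset_set; last exact: finite_image.
  apply/idP/imfsetP => [/set_mem[i _ <-]|[i _ ->]]; first by exists i.
  by apply: mem_set; exists i.
by rewrite card_imfset //= -cardE.
Qed.

Lemma threshold (f : nat -> nat) (t k : nat) : {homo f : i j / i <= j} ->
  f 0 < t -> t <= f k -> exists2 s, s < k & forall i, (t <= f i) = (s < i).
Proof.
move=> fm f0 fk; have ex : exists i, t <= f i by exists k.
case: (ex_minnP ex) => [[|s] fs mins]; first by rewrite leqNgt f0 in fs.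
exists s; first exact: mins.
by move=> i; apply/idP/idP => [/mins//|/fm]; apply: leq_trans.
Qed.

Lemma mnm_pure n (v : 'X_{1..n}) i : mdeg v <= v i -> v = (U_(i) *+ mdeg v)%MM.
Proof.
move=> dv; have vi : v i = mdeg v.
  by apply/eqP; rewrite eqn_leq dv andbT; apply: (bounded_mdeg (leqnn _)).
apply: esym; apply: lepm_mdeg_eq; last by rewrite mdegMn mdeg1 mul1n.
by apply/mnm_lepP => j; rewrite mulmnE mnm1E; case: eqP => [<-|_]; rewrite ?mul1n ?vi.
Qed.

Lemma mnm_pure_but1 n (v : 'X_{1..n}) i e : mdeg v = e.+1 -> e <= v i ->
  exists j, v = (U_(i) *+ e + U_(j))%MM.
Proof.
move=> dv vi; have le : (U_(i) *+ e <= v)%MM.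
  by apply/mnm_lepP => j; rewrite mulmnE mnm1E; case: eqP => [<-|_]; rewrite ?mul1n.
have : mdeg (v - U_(i) *+ e)%MM == 1.
  by have := dv; rewrite -[in LHS](submK le) mdegD mdegMn mdeg1 => /eqP; rewrite mul1n; lia.
by case/mdeg1P => j /eqP e1; exists j; rewrite -e1 addmC submK.
Qed.

End Counting.

(** * Comparing B(u) and its bounded version *)

Section BoundedBorel.
Variables (n d : nat) (u : 'X_{1..n}) (s M : nat).
Hypotheses (d_gt1 : 1 < d) (du : mdeg u = d) (bu : bounded d.-1 u).
Hypotheses (s_lt : s < n) (M_lt : M < n).
(* [s] and [M] are the indices, counted from 0, of the first and last variables of [u]. *)
Hypothesis prefix_gt0 : forall k, (0 < prefix_deg u k) = (s < k).
Hypothesis prefix_full : forall k, (d <= prefix_deg u k) = (M < k).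

Let embs (i : 'I_s.+1) : 'I_n := widen_ord s_lt i.
Let embM (i : 'I_M.+1) : 'I_n := widen_ord M_lt i.

Lemma embs_inj : injective embs.
Proof. by move=> i j /(congr1 val) /= ij; apply: val_inj. Qed.

Lemma embM_inj : injective embM.
Proof. by move=> i j /(congr1 val) /= ij; apply: val_inj. Qed.

Lemma prefix_le_d k : prefix_deg u k <= d.
Proof. by rewrite -du prefix_deg_le. Qed.

(** Otherwise the whole degree [d] would sit on the variable [s], against the bound [d - 1]. *)
Lemma s_lt_M : s < M.
Proof.
rewrite ltnNge; apply/negP => Ms; have := prefix_degS u (Ordinal s_lt).
have /= := bu (Ordinal s_lt); have := prefix_full s.+1; have := prefix_gt0 s; lia.
Qed.

Lemma borel_set_sub k k' (w : 'X_{1..n}) : k <= k' -> (borel_set k w `<=` borel_set k' w)%classic.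
Proof. by move=> kk' v [vw bv]; split=> // i; apply: leq_trans (bv i) kk'. Qed.

(** A monomial of degree [d] breaking the bound is some [x_i^d]; its prefix sums vanish up to [i],
    so those of [u] do too and [i <= s]. *)
Lemma borel_setU_powers :
  (borel_set d u = borel_set d.-1 u `|` range (fun i : 'I_s.+1 => (U_(embs i) *+ d)%MM))%classic.
Proof.
apply/seteqP; split=> v.
  move=> [vu bv]; have dv : mdeg v = d by rewrite vu.1.
  have [bv'|] := pselect (bounded d.-1 v); first by left.
  move=> /existsNP[i /negP]; rewrite -ltnNge prednK ?(ltnW d_gt1) // => vi.
  right; have vE : v = (U_(i) *+ d)%MM by rewrite -dv; apply: mnm_pure; rewrite dv.
  have is' : i < s.+1.
    have := vu.2 i; rewrite vE prefix_degMn prefix_deg1 ltnn leqNgt prefix_gt0.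
    by rewrite -leqNgt.
  by exists (Ordinal is') => //; rewrite vE; congr (U_(_) *+ _)%MM; apply: val_inj.
case; first by apply: borel_set_sub; rewrite leq_pred.
move=> [i _ <-]; split; last by apply: bounded_mdeg; rewrite mdegMn mdeg1 mul1n.
split=> [|k]; first by rewrite mdegMn mdeg1 mul1n.
rewrite prefix_degMn prefix_deg1 /=; have := prefix_le_d k; have := prefix_gt0 k.
by have := ltn_ord i; lia.
Qed.

Lemma mnmMn1E (i j : 'I_n) e : (U_(i) *+ e)%MM j = if i == j then e else 0.
Proof. by rewrite mulmnE mnm1E; case: eqP; rewrite ?mul1n. Qed.

Lemma card_borel_set :
  #|` fset_set (borel_set d u)|%fset = #|` fset_set (borel_set d.-1 u)|%fset + s.+1.
Proof.
rewrite borel_setU_powers card_setU_range ?card_ord //.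
- exact: finite_mdeg (@borel_set_deg _ _ _).
- move=> i j /(congr1 (fun m : 'X_{1..n} => m (embs i))) /=; rewrite !mnmMn1E eqxx.
  by case: eqP => [e'|_]; [rewrite (embs_inj e')|lia].
by move=> i [_ /(_ (embs i))]; rewrite mnmMn1E eqxx; lia.
Qed.

(** The case of equal indices gives the pure powers [x_i^(2d)]. *)
Let near_power (ij : 'I_s.+1 * 'I_M.+1) : 'X_{1..n} :=
  (U_(embs ij.1) *+ (d.*2).-1 + U_(embM ij.2))%MM.

Lemma borel_set2U_near_powers :
  (borel_set d.*2 (u + u)%MM = borel_set (d.-1).*2 (u + u)%MM `|` range near_power)%classic.
Proof.
apply/seteqP; split=> v.
  move=> [vu bv]; have dv : mdeg v = d.*2 by rewrite vu.1 mdegD du addnn.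
  have [bv'|] := pselect (bounded (d.-1).*2 v); first by left.
  move=> /existsNP[i /negP]; rewrite -ltnNge => vi.
  right; have [||j vE] := @mnm_pure_but1 _ v i (d.*2).-1; [lia|lia|].
  have pv k : prefix_deg v k = (i < k) * (d.*2).-1 + (j < k).
    by rewrite vE prefix_degD prefix_degMn !prefix_deg1.
  have is' : i < s.+1.
    have := vu.2 i; rewrite pv ltnn prefix_degD; have := prefix_gt0 i; lia.
  have jM : j < M.+1.
    have := vu.2 M.+1; rewrite pv prefix_degD; have := prefix_full M.+1; lia.
  by exists (Ordinal is', Ordinal jM) => //; rewrite vE.
case; first by apply: borel_set_sub; lia.
move=> [[i j] _ <-]; have dw : mdeg (near_power (i, j)) = d.*2.
  by rewrite /near_power mdegD mdegMn !mdeg1 mul1n; lia.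
split; last by apply: bounded_mdeg; rewrite dw.
split=> [|k]; first by rewrite dw mdegD du addnn.
rewrite prefix_degD /near_power /= prefix_degD prefix_degMn !prefix_deg1 /=.
have := prefix_le_d k; have := prefix_gt0 k; have := prefix_full k.
by have := ltn_ord i; have := ltn_ord j; nia.
Qed.

Lemma card_sumset2_borel_set :
  #|` fset_set (sumset (borel_set d u) 2)|%fset =
  #|` fset_set (sumset (borel_set d.-1 u) 2)|%fset + s.+1 * M.+1.
Proof.
rewrite !sumset2_borel_set borel_set2U_near_powers card_setU_range.
- by rewrite card_prod !card_ord.
- exact: finite_mdeg (@borel_set_deg _ _ _).
(* The index [i] is recovered as the only one with exponent at least [2d - 1], which exceeds 1. *)
- move=> [i j] [i' j'] e; have ii' : i = i'.
    have [//|neq] := eqVneq i i'.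
    have := congr1 (fun m : 'X_{1..n} => m (embs i)) e.
    rewrite /near_power /= !mnmDE !mnmMn1E !mnm1E eqxx.
    rewrite (inj_eq embs_inj) [i' == i]eq_sym (negPf neq).
    by have := leq_b1 (embM j' == embs i); lia.
  move: e; rewrite /near_power /= ii' => /addmI/eqP.
  by rewrite eq_mnm1 => /eqP/embM_inj->.
move=> [i j] [_ /(_ (embs i))].
by rewrite /near_power /= mnmDE mnmMn1E eqxx; lia.
Qed.

(** * Analytic spreads of the two ideals *)

Let o : 'I_n := Ordinal (leq_ltn_trans (leq0n s) s_lt).

Lemma top_mem (i : 'I_n) : i <= M -> borel_set d u (U_(o) *+ d.-1 + U_(i))%MM.
Proof.
move=> iM; have dw : mdeg (U_(o) *+ d.-1 + U_(i))%MM = d.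
  by rewrite mdegD mdegMn !mdeg1 mul1n; lia.
split; last by apply: bounded_mdeg; rewrite dw.
split=> [|k]; first by rewrite dw du.
rewrite prefix_degD prefix_degMn !prefix_deg1; case: k => [|k]; first by rewrite prefix_deg0.
by have := prefix_le_d k.+1; have := prefix_full k.+1; rewrite /= mul1n; lia.
Qed.

Lemma bounded_top_mem (i : 'I_n) : 0 < i <= M ->
  borel_set d.-1 u (U_(o) *+ d.-1 + U_(i))%MM.
Proof.
move=> /andP[i0 iM]; split; first exact: (top_mem iM).1.
move=> j; rewrite mnmDE mnmMn1E mnm1E.
have [<-|_] := eqVneq o j; last by have := leq_b1 (i == j); lia.
have -> : (i == o) = false by apply/eqP => e; rewrite e in i0.
by rewrite addn0.
Qed.

Lemma sumset_borel_eq0 k e (v : 'X_{1..n}) (i : 'I_n) :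
  sumset (borel_set k u) e v -> M < i -> v i = 0.
Proof.
elim: e v => [_ ->|e IH _ [a [b [[[da pa] _] /IH bi ->]]]] Mi; first by rewrite mnm0E.
rewrite mnmDE bi // addn0; have := prefix_degS a i; have := prefix_deg_le a i.+1.
by have := pa i; have := prefix_full i; rewrite Mi da du; lia.
Qed.

Lemma restrict_sumset_borel_inj k e e' (v v' : 'X_{1..n}) :
  sumset (borel_set k u) e v -> sumset (borel_set k u) e' v' ->
  restrict_mnm embM v = restrict_mnm embM v' -> v = v'.
Proof.
move=> sv sv' vv'; apply/mnmP => i; have [iM|Mi] := ltnP i M.+1; last first.
  by rewrite (sumset_borel_eq0 sv Mi) (sumset_borel_eq0 sv' Mi).
have := congr1 (fun m : 'X_{1..M.+1} => m (Ordinal iM)) vv'; rewrite !mnmE.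
by have -> : embM (Ordinal iM) = i by apply: val_inj.
Qed.

Variable K : fieldType.

Lemma borel_set_mdeg k a : borel_set k u a -> mdeg a = d.
Proof. by move/borel_set_deg => ->. Qed.

Let d_gt0 : 0 < d := ltnW d_gt1.

Lemma restrictD (l : nat) (tau : 'I_l -> 'I_n) (a b : 'X_{1..n}) :
  restrict_mnm tau (a + b)%MM = (restrict_mnm tau a + restrict_mnm tau b)%MM.
Proof. by apply/mnmP => j; rewrite !(mnmE, mnmDE). Qed.

Lemma restrict_power (l : nat) (tau : 'I_l -> 'I_n) (j : 'I_l) e : injective tau ->
  restrict_mnm tau (U_(tau j) *+ e)%MM = (U_(j) *+ e)%MM.
Proof.
move=> inj; apply/mnmP => j'; rewrite mnmE !mulmnE !mnm1E.
by rewrite (inj_eq inj).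
Qed.

(* [x_i^d] is the quotient of [(x_0^(d-1) x_i)^d] by [(x_0^d)^(d-1)]. *)
Lemma spread_borel : analytic_spread (@mono_ideal _ K (borel_set d u)) M.+1.
Proof.
apply: (@analytic_spread_mono _ _ d _ d_gt0 (@borel_set_mdeg d) _ embM).
  by move=> k k' v v'; apply: restrict_sumset_borel_inj.
move=> i; have Ai : borel_set d u (U_(o) *+ d.-1 + U_(embM i))%MM.
  by apply: top_mem; apply: (ltn_ord i).
have Ao : borel_set d u (U_(o) *+ d.-1 + U_(o))%MM by apply: top_mem.
exists ((U_(o) *+ d.-1 + U_(embM i)) *+ d)%MM, ((U_(o) *+ d.-1 + U_(o)) *+ d.-1)%MM, d.
split=> //; [exists (1 * d)|exists (1 * d.-1)|];
  try by apply: sumsetMn; apply: sumset1.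
rewrite -(restrict_power _ _ embM_inj) -restrictD; congr restrict_mnm.
apply/mnmP => j; rewrite !(mulmnE, mnmDE, mnm1E); case: (o == j); case: (embM i == j); nia.
Qed.

(* With [w_i = x_0^(d-1) x_i] and [z = x_0^(d-2) x_1 x_M] one has
   [w_1 w_M = x_0^d z], and [x_i^d] is the quotient of [w_i^d z^(d-1)] by
   [(w_1 w_M)^(d-1)]. *)
Lemma spread_bounded_borel : prefix_deg u 1 < d.-1 ->
  analytic_spread (@mono_ideal _ K (borel_set d.-1 u)) M.+1.
Proof.
move=> u0; have M0 : 0 < M := leq_ltn_trans (leq0n s) s_lt_M.
pose x1 : 'I_n := Ordinal (leq_ltn_trans M0 M_lt); pose xM : 'I_n := Ordinal M_lt.
pose w i := (U_(o) *+ d.-1 + U_(i))%MM; pose z := (U_(o) *+ d.-2 + U_(x1) + U_(xM))%MM.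
apply: (@analytic_spread_mono _ _ d _ d_gt0 (@borel_set_mdeg d.-1) _ embM).
  by move=> k k' v v'; apply: restrict_sumset_borel_inj.
have Aw (i : 'I_n) : 0 < i <= M -> borel_set d.-1 u (w i) by apply: bounded_top_mem.
have A1 : borel_set d.-1 u (w x1) by apply: Aw.
have AM : borel_set d.-1 u (w xM) by apply: Aw; rewrite M0 /=.
have Az : borel_set d.-1 u z.
  have dz : mdeg z = d by rewrite !mdegD mdegMn !mdeg1 mul1n; lia.
  split; first split; first by rewrite dz du.
    case=> [|k]; first by rewrite prefix_deg0.
    rewrite !prefix_degD prefix_degMn !prefix_deg1 /= mul1n.
    have := prefix_le_d k.+1; have := prefix_full k.+1.
    (* Only the first prefix sum of [z] is as small as [d - 2]; this is where [u0] enters. *)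
    by case: k => [|k]; [move: u0; lia|lia].
  move=> j; rewrite !mnmDE mnmMn1E !mnm1E.
  have ox1 : (o == x1) = false by [].
  have oxM : (o == xM) = false by apply/eqP => /(congr1 val) /= e; move: (M0); rewrite -e.
  have [<-|oj] := eqVneq o j; first by rewrite ![_ == o]eq_sym ox1 oxM; lia.
  have [M1|M1] := eqVneq M 1; last first.
    have : ~~ ((x1 == j) && (xM == j)).
      by apply/negP => /andP[/eqP <- /eqP/(congr1 val) /= e]; rewrite e in M1.
    by case: (x1 == j); case: (xM == j) => //= _; lia.
  (* Here [z] contains [x_1^2], so [d >= 3] is required: by [u0] the exponent of [x_1] in [u] is at
     least 2, and it is at most [d - 1]. *)
  have := prefix_degS u x1; have := bu x1; have := prefix_full 2; rewrite M1 /= => e1 e2 e3.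
  by have := leq_b1 (x1 == j); have := leq_b1 (xM == j); lia.
have A11 : sumset (borel_set d.-1 u) 2 (w x1 + w xM)%MM.
  by apply: (@sumsetD _ _ 1 1); apply: sumset1.
move=> i; have [i0|i0] := posnP i.
  exists (w x1 + w xM)%MM, z, d; split=> //; [by exists 2|by exists 1; apply: sumset1|].
  rewrite -(restrict_power _ _ embM_inj) -restrictD; congr restrict_mnm.
  have -> : embM i = o by apply: val_inj.
  apply/mnmP => j; rewrite !(mulmnE, mnmDE, mnm1E); case: (o == j); lia.
have Ai : borel_set d.-1 u (w (embM i)) by apply: Aw; rewrite i0; apply: (ltn_ord i).
exists (w (embM i) *+ d + z *+ d.-1)%MM, ((w x1 + w xM) *+ d.-1)%MM, d; split=> //.
- by exists (1 * d + 1 * d.-1); apply: sumsetD; apply: sumsetMn; apply: sumset1.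
- by exists (2 * d.-1); apply: sumsetMn.
rewrite -(restrict_power _ _ embM_inj) -restrictD; congr restrict_mnm.
apply/mnmP => j; rewrite !(mulmnE, mnmDE, mnm1E).
have -> : d = d.-2.+2 by lia.
by case: (o == j); case: (embM i == j); case: (x1 == j); case: (xM == j); nia.
Qed.

Lemma prefix_deg_first v : prefix_deg v 1 = v o.
Proof. by apply: etrans (prefix_degS v o) _; rewrite prefix_deg0. Qed.

(** * The case u = x_0^(d-1) x_M *)

Section Star.
Hypothesis u_star : prefix_deg u 1 = d.-1.

(** The underlying index is [j + 1], since [ltn_ord j] unfolds to [j.+1 <= M]. *)
Let skip0 (j : 'I_M) : 'I_n := Ordinal (leq_ltn_trans (ltn_ord j) M_lt).

Let star (j : 'I_M) : 'X_{1..n} := (U_(o) *+ d.-1 + U_(skip0 j))%MM.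

Lemma skip0_inj : injective skip0.
Proof. by move=> i j /(congr1 val) [ij]; apply: val_inj. Qed.

Lemma skip0P (i : 'I_n) : i != o -> i <= M -> exists j, i = skip0 j.
Proof.
move=> io iM; have i0 : 0 < i by rewrite lt0n; apply: contra io => /eqP i0; apply/eqP/val_inj.
have jM : i.-1 < M by lia.
by exists (Ordinal jM); apply: val_inj; rewrite /= prednK.
Qed.

Lemma star_mem j : borel_set d.-1 u (star j).
Proof. by apply: bounded_top_mem; rewrite /=; apply: ltn_ord. Qed.

Lemma borel_set_at0 v : borel_set d.-1 u v -> v o = d.-1.
Proof.
by move=> [[_ /(_ 1) pv] /(_ o) bv]; move: pv; rewrite u_star prefix_deg_first; lia.
Qed.

Lemma sumset_at0 e v : sumset (borel_set d.-1 u) e v -> v o = d.-1 * e.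
Proof.
elim: e v => [_ ->|e IH _ [a [b [/borel_set_at0 ao /IH bo ->]]]].
  by rewrite mnm0E muln0.
by rewrite mnmDE ao bo mulnS.
Qed.

(** The empty summand gives the shape counted by [card_setU_range]. *)
Lemma borel_set_starE : (borel_set d.-1 u = set0 `|` range star)%classic.
Proof.
rewrite set0U; apply/seteqP; split=> [v vu|_ [j _ <-]]; last exact: star_mem.
have [||i vE] := @mnm_pure_but1 _ v o d.-1.
- by rewrite (borel_set_mdeg vu) prednK.
- by rewrite (borel_set_at0 vu).
have io : i != o.
  apply/eqP => io; have := borel_set_at0 vu.
  by rewrite vE io mnmDE mnmMn1E mnm1E eqxx; lia.
have iM : i <= M.
  rewrite leqNgt; apply/negP => Mi; have := sumset_borel_eq0 (sumset1 vu) Mi.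
  by rewrite vE mnmDE mnm1E eqxx; lia.
by have [j ij] := skip0P io iM; exists j => //; rewrite vE ij.
Qed.

Lemma card_star : #|` fset_set (borel_set d.-1 u)|%fset = M.
Proof.
rewrite borel_set_starE card_setU_range ?fset_set0 ?cardfs0 ?card_ord //.
  by move=> i j /addmI/eqP; rewrite eq_mnm1 => /eqP/skip0_inj.
by move=> j [].
Qed.

Lemma spread_star : analytic_spread (@mono_ideal _ K (borel_set d.-1 u)) M.
Proof.
apply: (@analytic_spread_mono _ _ d _ d_gt0 (@borel_set_mdeg d.-1) _ skip0).
  move=> e e' v v' sv sv' vv'.
  have off i : i != o -> v i = v' i.
    move=> io; have [iM|Mi] := leqP i M; last first.
      by rewrite (sumset_borel_eq0 sv Mi) (sumset_borel_eq0 sv' Mi).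
    have [j ->] := skip0P io iM.
    by have := congr1 (fun m : 'X_{1..M} => m j) vv'; rewrite !mnmE.
  have dv := mdeg_sumset (@borel_set_mdeg d.-1) sv.
  have dv' := mdeg_sumset (@borel_set_mdeg d.-1) sv'.
  have vo := sumset_at0 sv; have v'o := sumset_at0 sv'.
  (* The degree [d e] minus the exponent [(d-1) e] of [x_0] is [e], a sum of exponents that the
     restriction retains. *)
  have ee' : e = e'.
    move: dv dv'; rewrite !mdegE (bigD1 o) // [in X in _ -> X -> _](bigD1 o) //=.
    by rewrite vo v'o (eq_bigr v') //; nia.
  apply/mnmP => i; have [->|] := eqVneq i o; last exact: off.
  by rewrite vo v'o ee'.
(* Once [x_0] is set to 1, a generator is a single variable; it is compared with 1 from the zeroth
   power. *)
move=> i; exists (star i), 0%MM, 1; split=> //.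
- by exists 1; apply/sumset1/star_mem.
- by exists 0.
apply/mnmP => j; rewrite !(mnmE, mnmDE, mulmnE, mnm1E) (inj_eq skip0_inj).
by have -> : (o == skip0 j) = false by []; rewrite muln1.
Qed.

End Star.

Lemma freiman_bounded_borel_set :
  freiman (@mono_ideal _ K (borel_set d.-1 u)) <->
  freiman (@mono_ideal _ K (borel_set d u)).
Proof.
rewrite (freiman_mono (@borel_set_mdeg d) spread_borel).
rewrite card_sumset2_borel_set card_borel_set.
have [star|nstar] := eqVneq (prefix_deg u 1) d.-1.
  rewrite (freiman_mono (@borel_set_mdeg d.-1) (spread_star star)) card_star //.
  have s0 : s = 0 by have := prefix_gt0 1; rewrite star; lia.
  (* The right side grows by [(M+1)^2 - M^2 - M = M + 1], exactly the loss in the square. *)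
  by rewrite binS bin1 s0; lia.
rewrite (freiman_mono (@borel_set_mdeg d.-1) (spread_bounded_borel _)); last first.
  by move: nstar; have := bu o; rewrite prefix_deg_first; lia.
(* With common spread [M + 1], both sides of the equation change by [(s+1)(M+1)]. *)
lia.
Qed.

End BoundedBorel.

Theorem theorem3p5 (n : nat) (hn : (3 <= n)%N) (K : fieldType)
    (d : nat) (hd : (2 <= d)%N) (u : 'X_{1..n})
    (hu : bounded d.-1 u) (hdeg : mdeg u = d) :
  freiman (principal_kborel K d.-1 u) <-> freiman (principal_borel K u).
Proof.
rewrite principal_kborelE // principal_borelE hdeg.
have full : prefix_deg u n = d by rewrite prefix_deg_all.
(* The prefix sums of [u] reach 1 at its first variable and [d] at its last. *)
have [|||s sn sP] := @threshold (prefix_deg u) 1 n; first exact: prefix_deg_mono.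
- by rewrite prefix_deg0.
- by rewrite full ltnW.
have [|||M Mn MP] := @threshold (prefix_deg u) d n; first exact: prefix_deg_mono.
- by rewrite prefix_deg0 ltnW.
- by rewrite full.
exact: freiman_bounded_borel_set hd hdeg hu sn Mn sP MP K.
Qed.
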